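(* Let $M$ be a $\mathfrak g$-manifold with a principal connection form $\omega$ and let $\Omega$ be its curvature form. Let $f\in L^k(\mathfrak g)^{\mathfrak g}$ be $\mathfrak g$-invariant under the adjoint action. Then the differential form $f^\Omega:=f^{\Omega,\dots,\Omega}\in\Omega^{2k}(M)^{\mathfrak g}$ is a closed $\mathfrak g$-invariant form. If moreover $M$ is a free $\mathfrak g$-manifold, then $\Omega$ and consequently $f^\Omega$ are horizontal, so $f^\Omega\in\Omega^{2k}_{\mathrm{hor}}(M)^{\mathfrak g}$ is a closed basic form.
   Context: $\mathfrak g$ is a finite-dimensional real Lie algebra. A $\mathfrak g$-manifold is a smooth manifold $M$ with a Lie algebra homomorphism $\zeta:\mathfrak g\to\mathfrak X(M)$; it is free if $X\mapsto\zeta_X(x)$ is injective for each $x$. Put $\zeta_x:\mathfrak g\to T_xM$, $X\mapsto\zeta_X(x)$. A principal connection form is $\omega\in\Omega^1(M;\mathfrak g)$ with $\mathcal L_{\zeta_X}\omega=-\operatorname{ad}(X)\circ\omega$ for all $X\in\mathfrak g$ and $\zeta_x\circ\omega_x\circ\zeta_x=\zeta_x$ for all $x\in M$. Its curvature form is $\Omega=d\omega+\tfrac12[\omega,\omega]^\wedge$, where $\tfrac12[\omega,\omega]^\wedge(\xi,\eta)=[\omega(\xi),\omega(\eta)]$. A form is horizontal if it is killed by $i_{\zeta_X}$ for all $X\in\mathfrak g$. A real-valued form $\varphi$ is $\mathfrak g$-invariant (written $\Omega^p(M)^{\mathfrak g}$) if $\mathcal L_{\zeta_X}\varphi=0$ for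 all $X$; $\Omega^p_{\mathrm{hor}}(M)^{\mathfrak g}$ is the space of basic forms, i.e. horizontal $\mathfrak g$-invariant forms. $L^k(\mathfrak g)^{\mathfrak g}$ is the space of $k$-linear functions $f:\mathfrak g^k\to\mathbb R$ with $\sum_{i=1}^kf(Y_1,\dots,[X,Y_i],\dots,Y_k)=0$ for all $X,Y_j\in\mathfrak g$. $f^\Omega=f\circ(\Omega\otimes_\wedge\dots\otimes_\wedge\Omega)$ is obtained by applying $f$ to the $\mathfrak g^{\otimes k}$-valued $2k$-form given by the iterated product $(\Phi\otimes_\wedge\Psi)(\xi_1,\dots,\xi_{p+q})=\frac1{p!q!}\sum_\sigma\operatorname{sign}(\sigma)\,\Phi(\xi_{\sigma1},\dots,\xi_{\sigma p})\otimes\Psi(\xi_{\sigma(p+1)},\dots,\xi_{\sigma(p+q)})$ for $\Phi$ of degree $p$ and $\Psi$ of degree $q$. *)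

(* Defs.v *)
From HB Require Import structures.
From mathcomp Require Import all_boot all_order all_fingroup all_algebra.
From mathcomp Require Import all_classical all_reals all_analysis.
Set Implicit Arguments. Unset Strict Implicit. Unset Printing Implicit Defensive.
Import GRing.Theory numFieldNormedType.Exports.
Local Open Scope classical_set_scope.
Local Open Scope ring_scope.

Section Smooth.
Context {R : realType} {n : nat}.

Fixpoint Ck {W : normedModType R} (k : nat) (U : set 'rV[R]_n)
    (F : 'rV[R]_n -> W) : Prop :=
  if k is k'.+1 then
    (forall z, U z -> differentiable F z) /\
    (forall v : 'rV[R]_n, Ck k' U (fun z => 'D_v F z))
  else forall z, U z -> {for z, continuous F}.

(* Meaningful for open U. *)
Definition smooth {W : normedModType R} (U : set 'rV[R]_n)
    (F : 'rV[R]_n -> W) : Prop :=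
  forall k, Ck k U F.

(* A vectType carries no norm, so smoothness and directional derivatives of
   maps into a finite-dimensional space V go through coordinates in V. *)
Definition vcoord {V : vectType R} (i : 'I_(\dim {:V})) (w : V) : R^o :=
  coord (vbasis {:V}) i w.

Definition smoothv {V : vectType R} (U : set 'rV[R]_n)
    (F : 'rV[R]_n -> V) : Prop :=
  forall i : 'I_(\dim {:V}), smooth U (fun z => vcoord i (F z)).

Definition dirder {V : vectType R} (F : 'rV[R]_n -> V) (z v : 'rV[R]_n) : V :=
  \sum_(i < \dim {:V})
     ('D_v (fun y => vcoord i (F y)) z : R) *: (vbasis {:V})`_i.

End Smooth.

Definition multilinear {R : realType} {k : nat} {V W : lmodType R}
    (f : ('I_k -> V) -> W) : Prop :=
  forall (v : 'I_k -> V) (a : 'I_k) (c : R) (y z : V),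
    f (dfwith v a (c *: y + z)) = c *: f (dfwith v a y) + f (dfwith v a z).

Definition alternating_map {R : realType} {k : nat} {V W : lmodType R}
    (f : ('I_k -> V) -> W) : Prop :=
  forall (v : 'I_k -> V) (a b : 'I_k), a != b -> v a = v b -> f v = 0.

Record lieAlgebra (R : realType) := LieAlgebra {
  lie_space :> vectType R;
  lie_br : lie_space -> lie_space -> lie_space;
  lie_br_linearl : forall Z, linear (lie_br ^~ Z);
  lie_br_linearr : forall Z, linear (lie_br Z);
  lie_br_alt : forall X, lie_br X X = 0;
  lie_br_jacobi : forall X Y Z,
    lie_br X (lie_br Y Z) + lie_br Y (lie_br Z X) + lie_br Z (lie_br X Y) = 0
}.

(* Smooth manifolds of dimension n, presented by a smooth atlas: chart i is
   the homeomorphism [coords i : chart_dom i -> img i] with inverse [param i]; the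
   values of [coords i] off [chart_dom i] and of [param i] off [img i] are
   irrelevant.  [chart_at x] is a chosen chart around x. *)
Record manifold (R : realType) (n : nat) := Manifold {
  points :> topologicalType;
  chart : Type;
  chart_dom : chart -> set points;
  coords : chart -> points -> 'rV[R]_n;
  param : chart -> 'rV[R]_n -> points;
  chart_at : points -> chart;
  points_hausdorff : hausdorff_space points;
  points_second_countable : @second_countable points;
  chart_dom_open : forall i, open (chart_dom i);
  img_open : forall i, open (coords i @` chart_dom i);
  coords_continuous : forall i x, chart_dom i x -> {for x, continuous (coords i)};
  param_continuous : forall i z, (coords i @` chart_dom i) z ->
    {for z, continuous (param i)};
  coordsK : forall i x, chart_dom i x -> param i (coords i x) = x;
  chart_at_dom : forall x, chart_dom (chart_at x) x;
  transition_smooth : forall i j,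
    smooth (coords i @` (chart_dom i `&` chart_dom j)) (coords j \o param i)
}.

Section Calculus.
Context {R : realType} {n : nat} {M : manifold R n}.
Implicit Types (V W : vectType R) (x : M) (i j : chart M).

Definition img i : set 'rV[R]_n := coords i @` chart_dom i.

(* T_xM is identified with R^n through the preferred chart [chart_at x]; the
   components in another chart i around x are obtained from the Jacobian of the
   transition map. *)
Definition tangent (x : M) : normedModType R := 'rV[R]_n.

Definition comp_in i x (v : tangent x) : 'rV[R]_n :=
  'D_v (coords i \o param (chart_at x)) (coords (chart_at x) x).

(* The tangent vector at x with components v in chart i. *)
Definition vect_of i x (v : 'rV[R]_n) : tangent x :=
  'D_v (coords (chart_at x) \o param i) (coords i x).

Definition vector_field := forall x : M, tangent x.

Definition vf_local (X : vector_field) i (z : 'rV[R]_n) : 'rV[R]_n :=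
  comp_in i (X (param i z)).

Definition smooth_vf (X : vector_field) : Prop :=
  forall i, smooth (img i) (vf_local X i).

(* In coordinates, [X, Y]^k = X^l d_l Y^k - Y^l d_l X^k, that is
   [X, Y] h = X (Y h) - Y (X h) on functions h. *)
Definition vf_br (X Y : vector_field) : vector_field := fun x =>
  let i := chart_at x in let z := coords i x in
  'D_(X x) (vf_local Y i) z - 'D_(Y x) (vf_local X i) z.

(* The V-valued p-forms are the elements of this type satisfying [is_dform]. *)
Definition dform (p : nat) V := forall x : M, ('I_p -> tangent x) -> V.

Definition form_local p V (phi : dform p V) i (z : 'rV[R]_n)
    (v : 'I_p -> 'rV[R]_n) : V :=
  phi (param i z) (fun a => vect_of i (param i z) (v a)).

Definition is_dform p V (phi : dform p V) : Prop :=
  [/\ forall x, multilinear (phi x),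
      forall x, alternating_map (phi x) &
      forall i (v : 'I_p -> 'rV[R]_n),
        smoothv (img i) (fun z => form_local phi i z v)].

(* Coordinate formula for the exterior derivative:
   (d phi)(v_0,...,v_p) = sum_a (-1)^a D_{v_a} phi(v_0,..^a..,v_p),
   the v_b being extended as constant vector fields of the chart. *)
Definition ext_d p V (phi : dform p V) : dform p.+1 V := fun x v =>
  let i := chart_at x in
  \sum_(a < p.+1) (-1) ^+ a *:
    dirder (fun z => form_local phi i z (fun b => v (lift a b)))
           (coords i x) (v a).

(* (L_X phi)(v_1,...,v_p) = X(phi(v_1,...,v_p)) - sum_a phi(..,[X,v_a],..),
   the v_a being extended as constant vector fields of the chart, for which
   [X, v_a] = - D_{v_a} X. *)
Definition lie_der p V (X : vector_field) (phi : dform p V) : dform p V :=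
  fun x v =>
  let i := chart_at x in let z := coords i x in
  dirder (fun y => form_local phi i y v) z (X x) +
  \sum_(a < p) phi x (dfwith v a ('D_(v a) (vf_local X i) z : tangent x)).

Definition insertion V (X : vector_field) p : dform p V -> dform p.-1 V :=
  match p with
  | 0 => fun _ _ _ => 0
  | q.+1 => fun phi x v =>
      phi x (fun a => if unlift ord0 a is Some b then v b else X x)
  end.

Definition wedge_prod p q V W (U : vectType R) (B : V -> W -> U)
    (phi : dform p V) (psi : dform q W) : dform (p + q) U := fun x v =>
  ((p`! * q`!)%:R)^-1 *:
  \sum_(s : 'S_(p + q)) (-1) ^+ s *:
    B (phi x (fun a => v (s (lshift q a)))) (psi x (fun b => v (s (rshift p b)))).

End Calculus.

Arguments vector_field {R n} M.
Arguments dform {R n} M p V.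
Arguments vf_br {R n M} X Y x.
Arguments form_local {R n M p V} phi i z v.
Arguments ext_d {R n M p V} phi x v.
Arguments lie_der {R n M p V} X phi x v.
Arguments insertion {R n M V} X {p} phi x v.
Arguments wedge_prod {R n M p q V W U} B phi psi x v.

Section Tensor.
Context {R : realType} {g : vectType R}.

(* The tensor power g^{(x) k}, as arrays of components with respect to the
   basis e_(a_1) (x) ... (x) e_(a_k), where e = vbasis {:g}. *)
Definition tpower (g : vectType R) (k : nat) : vectType R :=
  {ffun {ffun 'I_k -> 'I_(\dim {:g})} -> R^o}.

Definition tensor k (Y : g) (t : tpower g k) : tpower g k.+1 :=
  [ffun a : {ffun 'I_k.+1 -> 'I_(\dim {:g})} =>
     vcoord (a ord0) Y * t [ffun j => a (lift ord0 j)]].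

(* The linear map g^{(x) k} -> R induced by a k-linear f. *)
Definition tensor_lift k (f : ('I_k -> g) -> R) (t : tpower g k) : R^o :=
  \sum_(a : {ffun 'I_k -> 'I_(\dim {:g})})
     t a * f (fun j => (vbasis {:g})`_(a j)).

End Tensor.

Section GManifold.
Context {R : realType} {n : nat} {M : manifold R n} {g : lieAlgebra R}.

Definition is_gmanifold (zeta : g -> vector_field M) : Prop :=
  [/\ forall X, smooth_vf (zeta X),
      forall x, linear (fun X => zeta X x) &
      forall X Y x, zeta (lie_br X Y) x = vf_br (zeta X) (zeta Y) x].

Definition free_gmanifold (zeta : g -> vector_field M) : Prop :=
  forall x, injective (fun X => zeta X x).

Definition principal_connection (zeta : g -> vector_field M)
    (omega : dform M 1 g) : Prop :=
  [/\ is_dform omega,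
      forall X x v, lie_der (zeta X) omega x v = - lie_br X (omega x v) &
      forall X x, zeta (omega x (fun _ => zeta X x)) x = zeta X x].

Definition curvature (omega : dform M 1 g) : dform M 2 g := fun x v =>
  ext_d omega x v +
  lie_br (omega x (fun _ => v ord0)) (omega x (fun _ => v ord_max)).

Definition horizontal (zeta : g -> vector_field M) p (V : vectType R)
    (phi : dform M p V) : Prop :=
  forall X x v, insertion (zeta X) phi x v = 0.

Definition g_invariant (zeta : g -> vector_field M) p
    (phi : dform M p R^o) : Prop :=
  forall X x v, lie_der (zeta X) phi x v = 0.

Definition closed_form p (phi : dform M p R^o) : Prop :=
  forall x v, ext_d phi x v = 0.

Definition is_basic (zeta : g -> vector_field M) p
    (phi : dform M p R^o) : Prop :=
  [/\ is_dform phi, horizontal zeta phi & g_invariant zeta phi].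

(* L^k(g)^g *)
Definition invariant_multilinear k (f : ('I_k -> g) -> R) : Prop :=
  multilinear (f : ('I_k -> g) -> R^o) /\
  forall (X : g) (Y : 'I_k -> g),
    \sum_(a < k) f (dfwith Y a (lie_br X (Y a))) = 0.

(* Phi (x)_wedge ( ... (x)_wedge (Phi (x)_wedge 1)). *)
Fixpoint wedge_power (Phi : dform M 2 g) (k : nat) : dform M k.*2 (tpower g k) :=
  match k with
  | 0 => fun _ _ => [ffun _ => 1]
  | k'.+1 => wedge_prod (@tensor R g k') Phi (@wedge_power Phi k')
  end.

Arguments wedge_power Phi k x v : clear implicits.

(* f^Phi *)
Definition form_of k (f : ('I_k -> g) -> R) (Phi : dform M 2 g) :
    dform M k.*2 R^o :=
  fun x v => tensor_lift f (wedge_power Phi k x v).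

End GManifold.

Arguments curvature {R n M g} omega x v.
Arguments wedge_power {R n M g} Phi k x v.
Arguments form_of {R n M g k} f Phi x v.

(* Main.v *)
From HB Require Import structures.
Require Import Defs.
From mathcomp Require Import all_boot all_order all_fingroup all_algebra.
From mathcomp Require Import all_classical all_reals all_analysis.
From mathcomp Require Import ring lra zify.
Set Implicit Arguments. Unset Strict Implicit. Unset Printing Implicit Defensive.
Import Order.TTheory GRing.Theory Num.Theory numFieldNormedType.Exports.
Local Open Scope classical_set_scope.
Local Open Scope ring_scope.

(** Chern-Weil theory for a principal connection form [omega] of a Lie algebra
    action.

    Read in a chart, [omega] is a family of linear maps [A z : 'rV_n -> g], and
    its curvature is the family of skew forms
    [K z u v = D_u A(v) - D_v A(u) + [A u, A v]].  Three facts about [K] carry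
    the theorem.
    - The Bianchi identity [loc_bianchi]: the cyclic sum over [u, v, w] of
      [D_u K(v, w) + [A u, K(v, w)]] vanishes, by the symmetry of second
      derivatives ([derive_comm]) and the Jacobi identity.
    - If [A] has Lie derivative [- ad X0] along a field [X], then so has [K]
      ([loc_lie_curv]); this is the commutation of Lie and exterior derivatives.
    - If moreover [A z (X z) = X0], then [K z (X z) v = 0]
      ([loc_curv_horizontal]).  The condition holds for all vertical fields when
      the action is free, since then [omega] reproduces generators.

    The iterated wedge product unfolds into a single alternation
    ([wedge_power_entry], [form_of_alt_pairs]): up to the factor [2 ^- k],
    [f^Omega (v)] is the sum over all permutations [s] of [2k] positions of
    [sgn s * f (.., Omega (v_(s 2j), v_(s (2j+1))), ..)].
    Closedness: differentiating inside [f] gives terms with [D_u K], and the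
    invariance of [f] allows replacing them by the covariant derivative
    [D_u K + [A u, K]].  In the alternated sum over permutations of [2k + 1]
    positions the even 3-cycle of the differentiated pair and the direction of
    differentiation preserves every other factor, so that only cyclic sums
    remain, and these vanish by Bianchi ([sum_cycle3], [loc_chern_weil_closed]).
    Invariance: for each permutation separately, the Lie derivative of [f^Omega]
    is the sum of the terms with one curvature factor replaced by
    [- [X0, K]], which is zero by the invariance of [f]
    ([loc_chern_weil_invariant]).

    What is defined at a point [x] uses the preferred chart at [x], whereas
    derivatives need a whole neighbourhood.  Hence the exterior and the Lie
    derivative of 1-forms must be compared in two charts ([loc_d_trans],
    [loc_lie_trans]); the second derivatives of the transition map drop out by
    symmetry.  The curvature thereby has its local expression in every chart, and
    so has [f^Omega], which is algebraic in the curvature. *)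

(** * Symmetry of second derivatives *)

Section MixedDerivatives.
Context {R : realType} {V : normedModType R}.

Lemma is_derive_line (F : V -> R^o) (u p : V) (t : R) :
  derivable F (t *: u + p) u ->
  is_derive t 1 (fun s : R => F (s *: u + p)) ('D_u F (t *: u + p)).
Proof.
have E : (fun h : R => h^-1 *: (((fun s : R => F (s *: u + p)) \o shift t) (h *: 1)
            - F (t *: u + p))) =
         (fun h => h^-1 *: ((F \o shift (t *: u + p)) (h *: u) - F (t *: u + p))).
  by apply/funext => h /=; rewrite [h *: 1]mulr1 scalerDl addrA.
by move=> dF; split; rewrite /derivable /derive E.
Qed.

Lemma derive_comp_shift (F : V -> R^o) (w u p : V) :
  'D_u (F \o shift w) p = 'D_u F (p + w).
Proof.
have E : (fun h => h^-1 *: (((F \o shift w) \o shift p) (h *: u) - (F \o shift w) p)) =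
   (fun h => h^-1 *: ((F \o shift (p + w)) (h *: u) - F (p + w))).
  by apply/funext => h /=; rewrite addrA.
by rewrite /derive E.
Qed.

Lemma mean_value_line (F : V -> R^o) (u p : V) (s : R) : 0 < s ->
  (forall t, 0 <= t <= s -> differentiable F (t *: u + p)) ->
  exists2 t, 0 <= t <= s & F (s *: u + p) - F p = s * 'D_u F (t *: u + p).
Proof.
move=> s0 dF; pose f := fun t : R => F (t *: u + p) : R.
have df t : 0 <= t <= s -> is_derive t 1 f ('D_u F (t *: u + p)).
  by move=> /dF /diff_derivable ?; apply: is_derive_line.
have [||c hc E] := @MVT R f (fun t => 'D_u F (t *: u + p)) 0 s s0.
- by move=> t; rewrite in_itv/= => /andP[/ltW t0 /ltW ts]; apply: df; rewrite t0.
- by apply: derivable_within_continuous => t; rewrite in_itv/= => /df [].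
- move: hc; rewrite in_itv/= => /andP[/ltW c0 /ltW cs]; exists c; first by rewrite c0.
  by move: E; rewrite /f scale0r add0r subr0 mulrC.
Qed.

(** Both mixed derivatives are values of the same second difference quotient
    over the parallelogram spanned by [s *: u] and [s *: v]; this is the half
    where the increment in [u] is taken first. *)
Lemma second_difference (F : V -> R^o) (N : set V) (u v p : V) (s : R) : 0 < s ->
  (forall a b, 0 <= a <= s -> 0 <= b <= s -> N (a *: u + (b *: v + p))) ->
  (forall z, N z -> differentiable F z) ->
  (forall z, N z -> differentiable ('D_u F) z) ->
  exists2 q, N q & F (s *: u + (s *: v + p)) - F (s *: u + p) - F (s *: v + p)
                     + F p = s * (s * 'D_v ('D_u F) q).
Proof.
move=> s0 HN dF dDF.
pose G : V -> R^o := (F \o shift (s *: v)) - F.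
have N0 a : 0 <= a <= s -> N (a *: u + p).
  by move=> ha; rewrite -(add0r p) -(scale0r v); apply: HN => //; rewrite lexx ltW.
have Ns a : 0 <= a <= s -> N (s *: v + (a *: u + p)).
  by move=> ha; rewrite addrCA; apply: HN => //; rewrite ltW ?lexx.
have dFs a : 0 <= a <= s -> differentiable (F \o shift (s *: v)) (a *: u + p).
  move=> ha; apply: differentiable_comp => //=.
  by rewrite addrC; apply: dF; apply: Ns.
have [t ht Et] : exists2 t, 0 <= t <= s &
    G (s *: u + p) - G p = s * 'D_u G (t *: u + p).
  apply: mean_value_line => // t ht.
  by apply: differentiableB; [exact: dFs|exact/dF/N0].
have EG : 'D_u G (t *: u + p) = 'D_u F (s *: v + (t *: u + p)) - 'D_u F (t *: u + p).
  rewrite /G deriveB; last 2 first.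
  - exact/diff_derivable/dFs.
  - exact/diff_derivable/dF/N0.
  by congr (_ - _); rewrite derive_comp_shift addrC.
have Nt r : 0 <= r <= s -> N (r *: v + (t *: u + p)).
  by move=> hr; rewrite addrCA; apply: HN.
have [r hr Er] := mean_value_line s0 (fun r hr => dDF _ (Nt r hr)).
exists (r *: v + (t *: u + p)); first exact: Nt.
rewrite -Er -EG -Et /G /= !fctE /=.
rewrite (addrC (s *: u + p) (s *: v)) addrCA (addrC p (s *: v)).
ring.
Qed.

(** Small parallelograms with prescribed directions fit into every
    neighbourhood of their corner. *)
Lemma parallelogram_near (N : set V) (u v p : V) : nbhs p N ->
  exists2 s : R, 0 < s & forall a b, 0 <= a <= s -> 0 <= b <= s ->
    N (a *: u + (b *: v + p)).
Proof.
move=> /nbhs_ballP [r /= r0 rN]; pose k := `|u| + `|v| + 1.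
have k0 : 0 < k by rewrite ltr_wpDl // addr_ge0.
(* The factor [k] exceeds the sum of the norms, and is positive even if both
   vectors vanish. *)
exists (r / k); first by rewrite divr_gt0.
move=> a b /andP[a0 ar] /andP[b0 br]; apply: rN.
rewrite -ball_normE /ball_ /=.
have -> : p - (a *: u + (b *: v + p)) = - (a *: u + b *: v).
  by rewrite addrA opprD addrCA subrr addr0.
rewrite normrN (le_lt_trans (ler_normD _ _)) // !normrZ !ger0_norm //.
apply: (@le_lt_trans _ _ (r / k * `|u| + r / k * `|v|)).
  by rewrite lerD // ler_wpM2r.
rewrite -mulrDr mulrAC ltr_pdivrMr // ltr_pM2l // /k.
by rewrite ltrDl.
Qed.

Lemma dist_le_sum (W : normedModType R) (a b c : W) (d e : R) :
  `|a - c| < d -> `|b - c| < e -> `|a - b| <= d + e.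
Proof.
move=> ad be; apply: le_trans (ltW (ltrD ad be)).
have -> : a - b = (a - c) - (b - c) by rewrite opprB addrA subrK.
exact: ler_normB.
Qed.

(** Schwarz: on every small parallelogram the two mixed derivatives take a common
    value, at two different points; continuity moves both points to [p]. *)
Lemma derive_comm (F : V -> R^o) (u v p : V) :
  (\forall z \near p, differentiable F z) ->
  (\forall z \near p, differentiable ('D_u F) z) ->
  (\forall z \near p, differentiable ('D_v F) z) ->
  {for p, continuous ('D_v ('D_u F))} -> {for p, continuous ('D_u ('D_v F))} ->
  'D_v ('D_u F) p = 'D_u ('D_v F) p.
Proof.
move=> dF dFu dFv cvu cuv; apply/eqP; rewrite -subr_eq0 -normr_le0.
apply/ler_addgt0Pr => e e0; rewrite add0r.
have e20 : 0 < e / 2 by rewrite divr_gt0.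
have [A HA NA] : exists2 A, nbhs p A &
    forall z, A z -> `|'D_v ('D_u F) p - 'D_v ('D_u F) z| < e / 2.
  by move/cvgrPdist_lt : cvu => /(_ _ e20) H; eexists; first exact: H.
have [B HB NB] : exists2 B, nbhs p B &
    forall z, B z -> `|'D_u ('D_v F) p - 'D_u ('D_v F) z| < e / 2.
  by move/cvgrPdist_lt : cuv => /(_ _ e20) H; eexists; first exact: H.
pose N := [set z | [/\ differentiable F z, differentiable ('D_u F) z,
  differentiable ('D_v F) z, A z & B z]].
have HN : nbhs p N.
  have HAB : nbhs p (A `&` B) by exact: filterI.
  apply: filterS3 dF dFu (filterI dFv HAB) => z ? ? [? [? ?]].
  by split.
have [s s0 Hs] := parallelogram_near u v HN.
have NF z : N z -> differentiable F z by case.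
have NFu z : N z -> differentiable ('D_u F) z by case.
have NFv z : N z -> differentiable ('D_v F) z by case.
have [q1 [_ _ _ /NA N1 _] E1] := second_difference s0 Hs NF NFu.
have Hs' a b : 0 <= a <= s -> 0 <= b <= s -> N (a *: v + (b *: u + p)).
  by move=> ha hb; rewrite addrCA; apply: Hs.
have [q2 [_ _ _ _ /NB N2] E2] := second_difference s0 Hs' NF NFv.
have E : 'D_v ('D_u F) q1 = 'D_u ('D_v F) q2.
  apply: (mulfI (lt0r_neq0 s0)); apply: (mulfI (lt0r_neq0 s0)).
  apply: etrans (esym E1) _; apply: etrans _ E2.
  by rewrite [s *: v + (s *: u + p)]addrCA; congr (_ + _); exact: addrAC.
move: N1 N2; rewrite E => N1 N2.
have -> : e = e / 2 + e / 2 by exact: splitr.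
exact: (dist_le_sum N1 N2).
Qed.

End MixedDerivatives.

(** * Locality of differentiability *)

Section Locality.
Context {R : realType} {V W : normedModType R}.

(** Differentiability is local: a function which vanishes near [z] is its own
    remainder term, and two functions which agree near [z] differ by such a
    function. *)
Lemma near_eq_differentiable (F G : V -> W) (z : V) :
  (\near z, F z = G z) -> differentiable F z -> differentiable G z.
Proof.
move=> FG dF.
have -> : G = F + (G - F) by rewrite addrC subrK.
apply: differentiableD => //; apply/diff_locallyP.
pose H := G - F; rewrite -/H.
have Hz : \near z, H z = 0.
  by near=> y; rewrite /H !fctE (near FG y) ?subrr.
have Hz0 : \forall h \near (0 : V), H (h + z) = 0.
  by move: Hz; rewrite (near_shift 0 z); apply: filterS => h /=; rewrite subr0.
have H0 : H \o shift z = cst (H z) + 0 +o_ 0 id.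
  apply/eqaddoP => e e0; near=> h.
  rewrite !fctE (nbhs_singleton Hz) /= (near Hz0 h) // addr0 subr0 normr0.
  by rewrite mulr_ge0 // ltW.
have d0 : 'd (cst 0) z = 0 :> (V -> W) by exact: diff_cst.
have c0 : continuous ('d (cst (0 : W)) z : V -> W).
  by rewrite d0; exact: cst_continuous.
have dH : 'd H z = 'd (cst 0) z :> (V -> W) by apply: (diff_unique c0); rewrite d0.
rewrite dH; split; rewrite d0; first exact: cst_continuous.
exact: H0.
Unshelve. all: by end_near. Qed.

End Locality.

(** * Smooth functions *)

Section SmoothFunctions.
Context {R : realType} {n : nat}.
Local Notation E := 'rV[R]_n.
Implicit Types (U : set E) (W : normedModType R).

(** Openness of [U] enters because the derivatives of two functions which agree
    on [U] must agree on [U] again. *)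
Lemma Ck_ext W k U (F G : E -> W) : open U -> (forall z, U z -> F z = G z) ->
  Ck k U F -> Ck k U G.
Proof.
move=> oU; elim: k F G => [|k IH] F G FG /=.
  move=> cF z Uz; have nFG : \near z, F z = G z.
    by apply: filterS (open_nbhs_nbhs (conj oU Uz)) => y /FG.
  have cFz : F @ z --> F z by exact: cF.
  change (G @ z --> G z); rewrite -(FG _ Uz).
  exact: cvg_trans (near_eq_cvg nFG) cFz.
have nFG z : U z -> \near z, F z = G z.
  by move=> Uz; apply: filterS (open_nbhs_nbhs (conj oU Uz)) => y /FG.
move=> [dF CF]; split=> [z Uz|v].
  exact: (near_eq_differentiable (nFG z Uz) (dF z Uz)).
by apply: IH (CF v) => z Uz; apply: near_eq_derive; exact: nFG.
Qed.

Lemma Ck_pred W k U (F : E -> W) : Ck k.+1 U F -> Ck k U F.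
Proof.
elim: k F => [|k IH] F /= [dF CF].
  by move=> z Uz; apply: differentiable_continuous; exact: dF.
by split=> // v; apply: IH; exact: CF.
Qed.

Lemma Ck_cst W k U (c : W) : Ck k U (fun=> c).
Proof.
elim: k c => [|k IH] c /=; first by move=> z _; exact: cst_continuous.
split=> [z _|v]; first exact: differentiable_cst.
have -> : (fun z : E => 'D_v (fun=> c) z) = fun=> 0.
  by apply/funext => z; exact: derive_cst.
exact: IH.
Qed.

Lemma CkD W k U (F G : E -> W) : open U ->
  Ck k U F -> Ck k U G -> Ck k U (F + G).
Proof.
move=> oU; elim: k F G => [|k IH] F G /=.
  by move=> cF cG z Uz; apply: continuousD; [exact: cF|exact: cG].
move=> [dF CF] [dG CG]; split=> [z Uz|v].
  by apply: differentiableD; [exact: dF|exact: dG].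
apply: Ck_ext oU _ (IH _ _ (CF v) (CG v)) => z Uz.
by rewrite deriveD //; apply: diff_derivable; [exact: dF|exact: dG].
Qed.

Lemma CkM k U (F G : E -> R^o) : open U ->
  Ck k U F -> Ck k U G -> Ck k U (fun z => (F z : R) * G z : R^o).
Proof.
move=> oU; elim: k F G => [|k IH] F G.
  by move=> cF cG z Uz; apply: (@continuousM R E F G); [exact: cF|exact: cG].
move=> /[dup] /Ck_pred F' /= [dF CF] /[dup] /Ck_pred G' /= [dG CG].
split=> [z Uz|v].
  by apply: (@differentiableM R E F G); [exact: dF|exact: dG].
apply: Ck_ext oU _ (CkD oU (IH _ _ F' (CG v)) (IH _ _ G' (CF v))) => z Uz.
symmetry; apply: (@deriveM R E F G).
  by apply: diff_derivable; exact: dF.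
by apply: diff_derivable; exact: dG.
Qed.

Lemma Ck_linear W (W' : normedModType R) (L : {linear W -> W'}) k U (F : E -> W) :
  open U -> continuous L -> Ck k U F -> Ck k U (fun z => L (F z)).
Proof.
move=> oU cL; elim: k F => [|k IH] F /=.
  move=> cF z Uz; apply: (@continuous_comp _ _ _ F L); first exact: cF.
  exact: cL.
move=> [dF CF]; have dL y : differentiable L y by exact: linear_differentiable.
split=> [z Uz|v].
  by apply: (@differentiable_comp _ _ _ _ F L); first exact: dF.
apply: Ck_ext oU _ (IH _ (CF v)) => z Uz.
have dLF : differentiable (L \o F) z by exact: differentiable_comp (dF z Uz) (dL _).
rewrite (deriveE v dLF) (deriveE v (dF z Uz)).
by rewrite (diff_comp (dF z Uz) (dL _)) /= diff_lin.
Qed.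

Lemma smooth_differentiable W U (F : E -> W) z :
  smooth U F -> U z -> differentiable F z.
Proof. by move=> /(_ 1) [dF _] /dF. Qed.

Lemma smooth_derive W U (F : E -> W) v : smooth U F -> smooth U ('D_v F).
Proof. by move=> sF k; have [_ CF] := sF k.+1; exact: CF. Qed.

Lemma smooth_continuous W U (F : E -> W) z :
  smooth U F -> U z -> {for z, continuous F}.
Proof. by move=> /(_ 0) cF /cF. Qed.

Lemma smooth_ext W U (F G : E -> W) : open U ->
  (forall z, U z -> F z = G z) -> smooth U F -> smooth U G.
Proof. by move=> oU FG sF k; apply: Ck_ext oU FG (sF k). Qed.

Lemma smooth_cst W U (c : W) : smooth U (fun=> c).
Proof. by move=> k; exact: Ck_cst. Qed.

Lemma smoothM U (F G : E -> R^o) : open U ->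
  smooth U F -> smooth U G -> smooth U (fun z => (F z : R) * G z : R^o).
Proof. by move=> oU sF sG k; exact: CkM. Qed.

Lemma smooth_sum U (I : Type) (r : seq I) (P : pred I) (F : I -> E -> R^o) :
  open U -> (forall i, smooth U (F i)) ->
  smooth U (fun z => \sum_(i <- r | P i) (F i z : R) : R^o).
Proof.
move=> oU sF; elim: r => [|i r IH].
  by apply: smooth_ext oU _ (smooth_cst U 0) => z _; rewrite big_nil.
have s : smooth U ((fun z => if P i then F i z else 0) +
   (fun z => \sum_(j <- r | P j) (F j z : R) : R^o)).
  move=> k; apply: (CkD oU _ (IH k)); case: (P i); first exact: sF.
  exact: Ck_cst.
apply: smooth_ext oU _ s => z _.
by rewrite big_cons !fctE; case: (P i); rewrite ?add0r.
Qed.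

(** Sums of products are what a linear map with varying matrix, applied to a
    varying vector, looks like in coordinates. *)
Lemma derive_sum_prod m (a b : 'I_m -> E -> R^o) (z v : E) :
  (forall j, differentiable (a j) z) -> (forall j, differentiable (b j) z) ->
  let F : E -> R^o := fun y => \sum_(j < m) (a j y : R) * b j y in
  differentiable F z /\
  'D_v F z = \sum_(j < m) ((a j z : R) * 'D_v (b j) z + (b j z : R) * 'D_v (a j) z).
Proof.
move=> da db F.
have EF : F = \sum_(j < m) (a j * b j : E -> R^o).
  by apply/funext => y; rewrite fct_sumE.
have dab j : differentiable (a j * b j : E -> R^o) z by exact: (@differentiableM R E).
rewrite EF; split; first exact: differentiable_sum.
rewrite derive_sum => [|j]; last exact: diff_derivable.
by apply: eq_bigr => j _; rewrite (@deriveM R E) //; exact: diff_derivable.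
Qed.

End SmoothFunctions.

(** * Linear maps and coordinates *)

Section LinearProp.
Context {R : realType} {V W : lmodType R} (L : V -> W).
Hypothesis linL : linear L.

(** The maps below are linear only at the points of an open set, so that linearity
    is a hypothesis rather than a structure; this packs it locally. *)
Definition linear_map : {linear V -> W} :=
  HB.pack L (GRing.isLinear.Build R V W *:%R L linL).

Lemma lin_sum I (r : seq I) (P : pred I) (F : I -> V) :
  L (\sum_(i <- r | P i) F i) = \sum_(i <- r | P i) L (F i).
Proof. exact: (raddf_sum linear_map). Qed.

Lemma linD u v : L (u + v) = L u + L v. Proof. exact: (raddfD linear_map). Qed.
Lemma linN u : L (- u) = - L u. Proof. exact: (raddfN linear_map). Qed.
Lemma lin0 : L 0 = 0. Proof. exact: (raddf0 linear_map). Qed.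
Lemma linZ (c : R) u : L (c *: u) = c *: L u.
Proof. exact: (@linearZ_LR _ _ _ _ linear_map). Qed.

End LinearProp.

Section Coordinates.
Context {R : realType} {V : vectType R}.

Lemma vcoord_linear i : linear (@vcoord R V i).
Proof. by move=> c u v; rewrite /vcoord linearP. Qed.

Lemma vcoordK (w : V) : w = \sum_i (vcoord i w : R) *: (vbasis {:V})`_i.
Proof. by apply: coord_vbasis; rewrite memvf. Qed.

Lemma vcoord_sum (c : 'I_(\dim {:V}) -> R) i :
  vcoord i (\sum_j c j *: (vbasis {:V})`_j) = c i.
Proof. by rewrite /vcoord coord_sum_free // (basis_free (vbasisP fullv)). Qed.

Lemma vcoord_inj (u w : V) : (forall i, vcoord i u = vcoord i w) -> u = w.
Proof.
by move=> E; rewrite (vcoordK u) (vcoordK w); apply: eq_bigr => i _; rewrite E.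
Qed.

End Coordinates.

Lemma vcoord_lin (R : realType) (V W : vectType R) (L : V -> W) (w : V) i : linear L ->
  vcoord i (L w) = \sum_j (vcoord j w : R) * vcoord i (L (vbasis {:V})`_j).
Proof.
move=> linL; rewrite {1}(vcoordK w) (lin_sum linL) (lin_sum (vcoord_linear i)).
by apply: eq_bigr => j _; rewrite (linZ linL) (linZ (vcoord_linear i)).
Qed.

Lemma near_all (T : topologicalType) (z : T) (P : T -> Prop) :
  (forall y, P y) -> \forall y \near z, P y.
Proof. by move=> HP; exact: filterE. Qed.

(** * Calculus of maps into a finite-dimensional space *)

Section DirectionalDerivative.
Context {R : realType} {n : nat}.
Local Notation E := 'rV[R]_n.
Implicit Types (V W : vectType R) (U : set E) (z v u : E).

(** Read off coordinates, since a [vectType] has no norm. *)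
Definition vdiff V (F : E -> V) z :=
  forall i, differentiable (fun y => vcoord i (F y)) z.

Lemma vcoord_dirder V (F : E -> V) z v i :
  vcoord i (dirder F z v) = 'D_v (fun y => vcoord i (F y)) z.
Proof. by rewrite vcoord_sum. Qed.

Lemma dirder_linear V (F : E -> V) z : vdiff F z -> linear (dirder F z).
Proof.
move=> dF c u v; apply: vcoord_inj => i.
by rewrite vcoord_linear !vcoord_dirder !deriveE //; exact: linearP.
Qed.

Lemma near_eq_dirder V (F G : E -> V) z v :
  (\near z, F z = G z) -> dirder F z v = dirder G z v.
Proof.
move=> FG; apply: vcoord_inj => i; rewrite !vcoord_dirder.
by apply: near_eq_derive; apply: filterS FG => y ->.
Qed.

Lemma dirder_cst V (c : V) z v : dirder (fun=> c) z v = 0.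
Proof.
apply: vcoord_inj => i.
by rewrite vcoord_dirder derive_cst (lin0 (vcoord_linear i)).
Qed.

Lemma vdiff_cst V (c : V) z : vdiff (fun=> c) z.
Proof. by move=> i; exact: differentiable_cst. Qed.

(** The Leibniz rule from which all other product rules follow: in coordinates
    [Phi y (Y y)] is a sum of products of a coordinate of [Y] and an entry of
    the matrix of [Phi]. Linearity is assumed near [z], because the local
    expression of a form is linear at the points of the chart image. *)
Lemma dirder_apply V W (Phi : E -> V -> W) (Y : E -> V) z :
  (\forall y \near z, linear (Phi y)) ->
  (forall w, vdiff (Phi ^~ w) z) -> vdiff Y z ->
  vdiff (fun y => Phi y (Y y)) z /\
  forall v, dirder (fun y => Phi y (Y y)) z v =
    dirder (Phi ^~ (Y z)) z v + Phi z (dirder Y z v).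
Proof.
move=> linPhi dPhi dY; have linz := nbhs_singleton linPhi.
pose b i j y := vcoord i (Phi y (vbasis {:V})`_j).
have dprod i v := derive_sum_prod v dY (fun j => dPhi (vbasis {:V})`_j i).
have near_prod (Z : E -> V) i : \forall y \near z,
    \sum_j (vcoord j (Z y) : R) * b i j y = vcoord i (Phi y (Z y)).
  by apply: filterS linPhi => y ly; rewrite (vcoord_lin _ _ ly).
split=> [i|v].
  exact: near_eq_differentiable (near_prod Y i) (dprod i z).1.
apply: vcoord_inj => i; rewrite (linD (vcoord_linear i)) !vcoord_dirder.
rewrite -(near_eq_derive v (near_prod Y i)) (dprod i v).2.
rewrite -(near_eq_derive v (near_prod (fun=> Y z) i)).
have [_ ->] := derive_sum_prod v (fun j : 'I_(\dim {:V}) =>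
  differentiable_cst (vcoord j (Y z)) z) (fun j => dPhi (vbasis {:V})`_j i).
rewrite (vcoord_lin _ _ linz) -big_split /=; apply: eq_bigr => j _.
by rewrite derive_cst mulr0 addr0 vcoord_dirder [X in _ + X]mulrC.
Qed.

Lemma dirder_lin V W (L : V -> W) (F : E -> V) z v : linear L -> vdiff F z ->
  dirder (fun y => L (F y)) z v = L (dirder F z v).
Proof.
move=> linL dF.
have [|w|_ ->] := @dirder_apply V W (fun=> L) F z _ _ dF.
- exact: near_all.
- exact: vdiff_cst.
- by rewrite dirder_cst add0r.
Qed.

Lemma vdiff_lin V W (L : V -> W) (F : E -> V) z : linear L -> vdiff F z ->
  vdiff (fun y => L (F y)) z.
Proof.
move=> linL dF.
have [|w|] // := @dirder_apply V W (fun=> L) F z _ _ dF.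
exact: near_all.
Qed.

Lemma dirder_bilin V1 V2 W (B : V1 -> V2 -> W) (F : E -> V1) (G : E -> V2) z :
  (forall w, linear (B ^~ w)) -> (forall w, linear (B w)) ->
  vdiff F z -> vdiff G z ->
  vdiff (fun y => B (F y) (G y)) z /\
  forall v, dirder (fun y => B (F y) (G y)) z v =
    B (dirder F z v) (G z) + B (F z) (dirder G z v).
Proof.
move=> linl linr dF dG.
have [|w|d E] := @dirder_apply _ _ (fun y => B (F y)) G z _ _ dG.
- exact: near_all.
- exact: (vdiff_lin (linl w)).
- by split=> // v; rewrite E (dirder_lin v (linl _) dF).
Qed.

Lemma vdiffD V (F G : E -> V) z : vdiff F z -> vdiff G z ->
  vdiff (fun y => F y + G y) z.
Proof.
move=> dF dG i; have := differentiableD (dF i) (dG i).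
apply: near_eq_differentiable; apply: near_all => y.
by rewrite (linD (vcoord_linear i)).
Qed.

Lemma dirderD V (F G : E -> V) z v : vdiff F z -> vdiff G z ->
  dirder (fun y => F y + G y) z v = dirder F z v + dirder G z v.
Proof.
move=> dF dG; apply: vcoord_inj => i.
rewrite (linD (vcoord_linear i)) !vcoord_dirder -deriveD; last 2 first.
- exact/diff_derivable.
- exact/diff_derivable.
apply: near_eq_derive; apply: near_all => y.
by rewrite (linD (vcoord_linear i)).
Qed.

Lemma opp_linear V : linear (@GRing.opp V).
Proof. by move=> c u v; rewrite opprD scalerN. Qed.

Lemma dirderB V (F G : E -> V) z v : vdiff F z -> vdiff G z ->
  dirder (fun y => F y - G y) z v = dirder F z v - dirder G z v.
Proof.
move=> dF dG; rewrite dirderD ?(dirder_lin v (@opp_linear V)) //.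
exact: (vdiff_lin (@opp_linear V)).
Qed.

Lemma dirder_comp V (F : E -> V) (t : E -> E) z v :
  differentiable t z -> vdiff F (t z) ->
  vdiff (F \o t) z /\ dirder (F \o t) z v = dirder F (t z) ('D_v t z).
Proof.
move=> dt dF; split=> [i|].
  exact: (@differentiable_comp _ _ _ _ t (fun y => vcoord i (F y))).
apply: vcoord_inj => i; rewrite !vcoord_dirder.
rewrite (deriveE _ (@differentiable_comp _ _ _ _ t (fun y => vcoord i (F y)) _ dt (dF i))).
rewrite (@diff_comp _ _ _ _ t (fun y => vcoord i (F y)) _ dt (dF i)) /=.
by rewrite deriveE // deriveE.
Qed.

Lemma smoothv_vdiff V U (F : E -> V) z : smoothv U F -> U z -> vdiff F z.
Proof. by move=> sF Uz i; exact: smooth_differentiable (sF i) Uz. Qed.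

Lemma smoothv_dirder V U (F : E -> V) u : smoothv U F ->
  smoothv U (fun y => dirder F y u).
Proof.
move=> sF i; have -> : (fun y => vcoord i (dirder F y u)) =
    'D_u (fun y => vcoord i (F y)).
  by apply/funext => y; rewrite vcoord_dirder.
exact: smooth_derive.
Qed.

Lemma smoothv_ext V U (F G : E -> V) : open U -> (forall z, U z -> F z = G z) ->
  smoothv U F -> smoothv U G.
Proof.
by move=> oU FG sF i; apply: smooth_ext oU _ (sF i) => z /FG ->.
Qed.

Lemma smoothv_apply V W U (Phi : E -> V -> W) (Y : E -> V) : open U ->
  (forall y, U y -> linear (Phi y)) -> (forall w, smoothv U (Phi ^~ w)) ->
  smoothv U Y -> smoothv U (fun y => Phi y (Y y)).
Proof.
move=> oU linPhi sPhi sY i.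
have s := smooth_sum (index_enum _) predT oU
  (fun j => smoothM oU (sY j) (sPhi (vbasis {:V})`_j i)).
by apply: smooth_ext oU _ s => z /linPhi lz; rewrite (vcoord_lin _ _ lz).
Qed.

Lemma smoothv_cst V U (c : V) : smoothv U (fun=> c).
Proof. by move=> i; exact: smooth_cst. Qed.

Lemma smoothv_lin V W U (L : V -> W) (F : E -> V) : open U -> linear L ->
  smoothv U F -> smoothv U (fun y => L (F y)).
Proof.
move=> oU linL; apply: (@smoothv_apply V W U (fun=> L) F) => // w.
exact: smoothv_cst.
Qed.

Lemma smoothvD V U (F G : E -> V) : open U -> smoothv U F -> smoothv U G ->
  smoothv U (fun y => F y + G y).
Proof.
move=> oU sF sG i.
have s : smooth U ((fun y => vcoord i (F y)) + (fun y => vcoord i (G y))).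
  by move=> k; apply: CkD => //; [exact: sF|exact: sG].
by apply: smooth_ext oU _ s => z _; rewrite (linD (vcoord_linear i)).
Qed.

Lemma dirder_comm V U (F : E -> V) z u v : open U -> smoothv U F -> U z ->
  dirder (fun y => dirder F y u) z v = dirder (fun y => dirder F y v) z u.
Proof.
move=> oU sF Uz; apply: vcoord_inj => i.
apply: etrans (vcoord_dirder _ _ _ _) _.
apply: etrans _ (esym (vcoord_dirder _ _ _ _)).
have H w : (fun y => vcoord i (dirder F y w)) = 'D_w (fun y => vcoord i (F y)).
  by apply/funext => y; rewrite vcoord_dirder.
have nU P : (forall y, U y -> P y) -> \forall y \near z, P y.
  by move=> UP; exact: filterS UP (open_nbhs_nbhs (conj oU Uz)).
rewrite !H; apply: derive_comm.
- by apply: nU => y; exact: smooth_differentiable.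
- by apply: nU => y; apply: smooth_differentiable; exact: smooth_derive.
- by apply: nU => y; apply: smooth_differentiable; exact: smooth_derive.
- by apply: smooth_continuous Uz; do 2![apply: smooth_derive].
- by apply: smooth_continuous Uz; do 2![apply: smooth_derive].
Qed.

(** Vector fields take values in ['rV_m], which is both a normed space and a
    [vectType]. Continuity of the coordinates makes the two notions of
    smoothness and of derivative agree. *)
Lemma vcoord_rV_continuous m i : continuous (@vcoord R 'rV[R]_m i).
Proof.
move=> w; apply: differentiable_continuous.
pose c k := vcoord i (delta_mx 0 k : 'rV[R]_m).
have [d _] := @derive_sum_prod R m m (fun k y => y 0 k) (fun k => fun=> c k) w 0
  (fun k => differentiable_coord w 0 k) (fun k => differentiable_cst (c k) w).
apply: near_eq_differentiable d; apply: near_all => y.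
rewrite {2}(row_sum_delta y) (lin_sum (vcoord_linear i)).
by apply: eq_bigr => k _; rewrite (linZ (vcoord_linear i)).
Qed.

Lemma smooth_smoothv m U (X : E -> 'rV[R]_m) : open U -> smooth U X -> smoothv U X.
Proof.
move=> oU sX i k.
have cL : continuous (linear_map (@vcoord_linear R 'rV[R]_m i)).
  exact: vcoord_rV_continuous.
exact: (Ck_linear oU cL (sX k)).
Qed.

Lemma dirder_derive m (X : E -> 'rV[R]_m) z v :
  differentiable X z -> dirder X z v = 'D_v X z.
Proof.
move=> dX; apply: vcoord_inj => i; rewrite vcoord_dirder.
pose L := linear_map (@vcoord_linear R 'rV[R]_m i).
have cL : continuous L by exact: vcoord_rV_continuous.
have dL y : differentiable L y by exact: linear_differentiable.
have dLX : differentiable (L \o X) z by exact: differentiable_comp dX (dL _).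
by rewrite (deriveE v dLX) (diff_comp dX (dL _)) /= diff_lin // (deriveE v dX).
Qed.

Lemma differentiable_vdiff m (X : E -> 'rV[R]_m) z : differentiable X z -> vdiff X z.
Proof.
move=> dX i.
pose L := linear_map (@vcoord_linear R 'rV[R]_m i).
have cL : continuous L by exact: vcoord_rV_continuous.
exact: (@differentiable_comp _ _ _ _ X L _ dX (linear_differentiable _ cL)).
Qed.

End DirectionalDerivative.

(** * Identities in a Lie algebra *)

Section LieIdentities.
Context {R : realType} {g : lieAlgebra R}.
Implicit Types X Y Z : g.
Local Notation br := (@lie_br R g).

Lemma lie_brDl X Y Z : br (X + Y) Z = br X Z + br Y Z.
Proof. exact: (linD (lie_br_linearl Z)). Qed.
Lemma lie_brDr X Y Z : br Z (X + Y) = br Z X + br Z Y.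
Proof. exact: (linD (lie_br_linearr Z)). Qed.
Lemma lie_brNl X Z : br (- X) Z = - br X Z.
Proof. exact: (linN (lie_br_linearl Z)). Qed.
Lemma lie_brNr X Z : br Z (- X) = - br Z X.
Proof. exact: (linN (lie_br_linearr Z)). Qed.

Lemma lie_brPl (c : R) X Y Z : br (c *: X + Y) Z = c *: br X Z + br Y Z.
Proof. exact: lie_br_linearl. Qed.

Lemma lie_br_anti X Y : br X Y = - br Y X.
Proof.
have /eqP := lie_br_alt (X + Y).
by rewrite lie_brDl !lie_brDr !lie_br_alt add0r addr0 addr_eq0 => /eqP.
Qed.

Lemma lie_br_derivation X Y Z : br X (br Y Z) = br (br X Y) Z + br Y (br X Z).
Proof.
have /eqP := lie_br_jacobi X Y Z; rewrite -addrA addr_eq0 => /eqP ->.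
by rewrite opprD (lie_br_anti (br X Y)) (lie_br_anti X Z) lie_brNr addrC.
Qed.

(** Identities in [g] are checked one coordinate at a time, where they become
    linear identities over [R]. *)
Definition crd i X : R := vcoord i X.

Lemma crd_inj X Y : (forall i, crd i X = crd i Y) -> X = Y.
Proof. exact: vcoord_inj. Qed.
Lemma crdD i X Y : crd i (X + Y) = crd i X + crd i Y.
Proof. exact: (linD (vcoord_linear i)). Qed.
Lemma crdN i X : crd i (- X) = - crd i X.
Proof. exact: (linN (vcoord_linear i)). Qed.
Lemma crd0 i : crd i 0 = 0.
Proof. exact: (lin0 (vcoord_linear i)). Qed.
Definition crdE := (crdD, crdN, crd0).

(** The algebra of the Bianchi identity, with [a, b, c] for the values of the
    connection form at three vectors, [puv] for its first derivatives and
    [s1, s2, s3] for its second ones. *)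
Lemma bianchi_identity (a b c s1 s2 s3 puv puw pvu pvw pwu pwv : g) :
  (s1 - s2 + (br puv c + br b puw) + br a (pvw - pwv + br b c)) +
  (s3 - s1 + (br pvw a + br c pvu) + br b (pwu - puw + br c a)) +
  (s2 - s3 + (br pwu b + br a pwv) + br c (puv - pvu + br a b)) = 0.
Proof.
rewrite !(lie_brDr, lie_brNr).
rewrite (lie_br_anti puv c) (lie_br_anti pvw a) (lie_br_anti pwu b).
have J := lie_br_jacobi a b c.
apply: crd_inj => i; have := congr1 (crd i) J.
rewrite !crdE => Ji; lra.
Qed.

(** The algebra behind the Lie derivative of the curvature. The letters stand for
    the terms of [loc_lie_curv]; the hypotheses are the Lie derivative of the
    connection form at two vectors and its derivatives in the other direction,
    in which the symmetric term [m] occurs twice and cancels. *)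
Lemma lie_curvature_identity (x a b pu pv qu qv suv svu tuv tvu ruv rvu m duv dvu : g) :
  pu + qu = - br x a -> pv + qv = - br x b ->
  suv + tuv + (ruv + m) = - br x duv -> svu + tvu + (rvu + m) = - br x dvu ->
  suv - svu + (br pu b + br a pv) + (tuv - rvu + br qu b) +
    (ruv - tvu + br a qv) = - br x (duv - dvu + br a b).
Proof.
move=> Eu Ev E1 E2; rewrite !(lie_brDr, lie_brNr) lie_br_derivation.
have := congr1 (br ^~ b) Eu; have := congr1 (br a) Ev.
rewrite /= !(lie_brDl, lie_brNl, lie_brDr, lie_brNr) => Ev' Eu'.
apply: crd_inj => i.
move: E1 E2 Eu' Ev' => /(congr1 (crd i)) E1 /(congr1 (crd i)) E2.
move=> /(congr1 (crd i)) E3 /(congr1 (crd i)) E4.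
by move: E1 E2 E3 E4; rewrite !crdE => E1 E2 E3 E4; lra.
Qed.

Lemma horizontality_identity (x a p q r : g) :
  0 = r + q -> p + q = - br x a -> p - r + br x a = 0.
Proof.
move=> E1 E2; apply: crd_inj => i.
have := congr1 (crd i) E1; have := congr1 (crd i) E2.
by rewrite !crdE => H1 H2; lra.
Qed.

End LieIdentities.

(** * The curvature of a local connection form *)

Section LocalForms.
Context {R : realType} {n : nat}.
Local Notation E := 'rV[R]_n.

Lemma open_near (U : set E) (z : E) (P : E -> Prop) : open U -> U z ->
  (forall y, U y -> P y) -> \forall y \near z, P y.
Proof. by move=> oU Uz UP; exact: filterS UP (open_nbhs_nbhs (conj oU Uz)). Qed.

Lemma scale_linear (V : lmodType R) (c : R) : linear (fun w : V => c *: w).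
Proof. by move=> a u v; rewrite scalerDr !scalerA mulrC. Qed.

(** The exterior derivative of a 1-form on ['rV_n], applied to the constant
    vector fields [u] and [v]. *)
Definition loc_d (V : vectType R) (A : E -> E -> V) (z u v : E) : V :=
  dirder (A ^~ v) z u - dirder (A ^~ u) z v.

Section OneForm.
Context {V : vectType R} {U : set E} {A : E -> E -> V}.
Hypotheses (oU : open U) (linA : forall z, U z -> linear (A z)).
Hypothesis (smA : forall v, smoothv U (A ^~ v)).

Lemma dirder_arg_linear z w : U z -> linear (fun v => dirder (A ^~ v) z w).
Proof.
move=> Uz c u v; have d x : vdiff (A ^~ x) z by exact: smoothv_vdiff (smA x) Uz.
rewrite -(dirder_lin _ (scale_linear c) (d u)) -dirderD //; last first.
  exact: vdiff_lin (scale_linear c) (d u).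
by apply: near_eq_dirder; apply: (open_near oU Uz) => y Uy; rewrite linA.
Qed.

Lemma dirder_moving_arg (Y : E -> E) z : U z -> vdiff Y z ->
  vdiff (fun y => A y (Y y)) z /\ forall v, dirder (fun y => A y (Y y)) z v =
    dirder (A ^~ (Y z)) z v + A z (dirder Y z v).
Proof.
move=> Uz dY; apply: dirder_apply => // [|w].
  exact: open_near oU Uz linA.
exact: smoothv_vdiff (smA w) Uz.
Qed.

(** The direction of a derivative may itself move. *)
Lemma dirder_moving_direction (Y : E -> E) v z : U z -> vdiff Y z ->
  vdiff (fun y => dirder (A ^~ v) y (Y y)) z /\
  forall u, dirder (fun y => dirder (A ^~ v) y (Y y)) z u =
    dirder (fun y => dirder (A ^~ v) y (Y z)) z u + dirder (A ^~ v) z (dirder Y z u).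
Proof.
move=> Uz dY.
apply: (@dirder_apply _ _ _ _ (fun y w => dirder (A ^~ v) y w)) => // [|w].
  apply: (open_near oU Uz) => y Uy; apply: dirder_linear.
  exact: smoothv_vdiff (smA v) Uy.
by apply: (smoothv_vdiff _ Uz); apply: smoothv_dirder; exact: smA.
Qed.

Lemma loc_d_linearl z v : U z -> linear (fun u => loc_d A z u v).
Proof.
move=> Uz c u w; rewrite /loc_d dirder_arg_linear //.
rewrite (dirder_linear (smoothv_vdiff (smA v) Uz)) scalerBr.
by rewrite opprD addrACA.
Qed.

Lemma loc_d_anti z u v : loc_d A z u v = - loc_d A z v u.
Proof. by rewrite /loc_d opprB. Qed.

Lemma smoothv_loc_d u v : smoothv U (fun z => loc_d A z u v).
Proof.
apply: smoothvD => //; first exact: smoothv_dirder.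
exact: smoothv_lin oU (@opp_linear _ V) (smoothv_dirder v (smA u)).
Qed.

Lemma dirder_loc_d z u v w : U z -> dirder (fun y => loc_d A y u v) z w =
  dirder (fun y => dirder (A ^~ v) y u) z w -
  dirder (fun y => dirder (A ^~ u) y v) z w.
Proof.
move=> Uz; have d a b : vdiff (fun y => dirder (A ^~ b) y a) z.
  by apply: smoothv_vdiff Uz; exact: smoothv_dirder.
exact: dirderB.
Qed.

End OneForm.

Section Curvature.
Context {g : lieAlgebra R} {U : set E} {A : E -> E -> g}.
Local Notation br := (@lie_br R g).
Hypotheses (oU : open U) (linA : forall z, U z -> linear (A z)).
Hypothesis (smA : forall v, smoothv U (A ^~ v)).

Definition loc_curv (A : E -> E -> g) (z u v : E) : g :=
  loc_d A z u v + br (A z u) (A z v).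
Local Notation K := (loc_curv A).

Lemma loc_curv_anti z u v : K z u v = - K z v u.
Proof. by rewrite /loc_curv loc_d_anti lie_br_anti -opprD. Qed.

Lemma loc_curv_linearl z v : U z -> linear (fun u => K z u v).
Proof.
move=> Uz c u w; rewrite /loc_curv (loc_d_linearl oU linA smA) // linA //.
by rewrite lie_brPl addrACA -scalerDr.
Qed.

Lemma loc_curv_linearr z u : U z -> linear (K z u).
Proof.
move=> Uz c v w; have /= H := loc_curv_linearl u Uz c v w.
by rewrite loc_curv_anti H opprD -scalerN -!loc_curv_anti.
Qed.

Lemma smoothv_loc_curv u v : smoothv U (fun z => K z u v).
Proof.
apply: smoothvD => //; first exact: smoothv_loc_d.
apply: (smoothv_apply (Phi := fun y => br (A y u))) => //.
  by move=> y _; exact: lie_br_linearr.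
by move=> w; apply: (smoothv_lin oU (lie_br_linearl w)).
Qed.

Lemma dirder_loc_curv z u v w : U z -> dirder (fun y => K y u v) z w =
  dirder (fun y => dirder (A ^~ v) y u) z w -
  dirder (fun y => dirder (A ^~ u) y v) z w +
  (br (dirder (A ^~ u) z w) (A z v) + br (A z u) (dirder (A ^~ v) z w)).
Proof.
move=> Uz; have dA x : vdiff (A ^~ x) z by exact: smoothv_vdiff (smA x) Uz.
have [dbr Ebr] := dirder_bilin (@lie_br_linearl R g) (@lie_br_linearr R g) (dA u) (dA v).
rewrite -(dirder_loc_d smA) // -Ebr; apply: dirderD => //.
exact: smoothv_vdiff (smoothv_loc_d oU smA _ _) Uz.
Qed.

(** Second Bianchi identity: the covariant derivative of the curvature has
    vanishing cyclic sum, because second derivatives commute and the bracket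
    satisfies the Jacobi identity. *)
Lemma loc_bianchi z u v w : U z ->
  let D a b c := dirder (fun y => K y b c) z a + br (A z a) (K z b c) in
  D u v w + D v w u + D w u v = 0.
Proof.
move=> Uz D; rewrite /D !dirder_loc_curv // /loc_curv /loc_d.
rewrite (dirder_comm v u oU (smA w) Uz) (dirder_comm w u oU (smA v) Uz).
rewrite (dirder_comm w v oU (smA u) Uz).
exact: bianchi_identity.
Qed.

Section Symmetry.
Context {X : E -> E} {X0 : g}.
Hypotheses (smX : smoothv U X) (LA : forall z v, U z ->
  dirder (A ^~ v) z (X z) + A z (dirder X z v) = - br X0 (A z v)).

(** The hypothesis on [A] is differentiated in the directions [u] and [v]; the
    skew part of the result is the claim, because second derivatives of [A] and
    of [X] are symmetric. *)
Lemma loc_lie_curv z u v : U z ->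
  dirder (fun y => K y u v) z (X z) + K z (dirder X z u) v + K z u (dirder X z v)
  = - br X0 (K z u v).
Proof.
move=> Uz; have dX : vdiff X z by exact: smoothv_vdiff smX Uz.
have dA x : vdiff (A ^~ x) z by exact: smoothv_vdiff (smA x) Uz.
have dLA a b : dirder (fun y => dirder (A ^~ b) y (X z)) z a +
    dirder (A ^~ b) z (dirder X z a) + (dirder (A ^~ (dirder X z b)) z a +
    A z (dirder (fun y => dirder X y b) z a)) = - br X0 (dirder (A ^~ b) z a).
  have dXb : vdiff (fun y => dirder X y b) z.
    by apply: smoothv_vdiff Uz; exact: smoothv_dirder.
  have [d1 <-] := dirder_moving_direction oU smA b Uz dX.
  have [d2 <-] := dirder_moving_arg oU linA smA Uz dXb.
  rewrite -dirderD // -lie_brNr -(dirder_lin _ (@opp_linear _ g)) //.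
  rewrite -(dirder_lin _ (lie_br_linearr X0)); last exact: vdiff_lin (@opp_linear _ g) _.
  apply: near_eq_dirder; apply: (open_near oU Uz) => y Uy.
  by rewrite LA // lie_brNr.
have E1 := dLA u v; have E2 := dLA v u.
rewrite (dirder_comm u v oU smX Uz) in E2.
rewrite dirder_loc_curv // /loc_curv /loc_d.
rewrite (dirder_comm u (X z) oU (smA v) Uz) (dirder_comm v (X z) oU (smA u) Uz).
exact: lie_curvature_identity (LA u Uz) (LA v Uz) E1 E2.
Qed.

(** Differentiating the constant [A y (X y)] turns the hypothesis on the Lie
    derivative into Cartan's formula for the contraction of [K] with [X]. *)
Lemma loc_curv_horizontal z v : U z -> (forall y, U y -> A y (X y) = X0) ->
  K z (X z) v = 0.
Proof.
move=> Uz AX; have dX : vdiff X z by exact: smoothv_vdiff smX Uz.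
have [_ /(_ v)] := dirder_moving_arg oU linA smA Uz dX.
rewrite (@near_eq_dirder _ _ _ _ (fun=> X0)); last exact: open_near oU Uz AX.
rewrite dirder_cst => E1; have E2 := LA v Uz.
rewrite /loc_curv /loc_d AX //; exact: horizontality_identity E1 E2.
Qed.

End Symmetry.
End Curvature.
End LocalForms.

(** * Multilinear maps *)

Section Multilinear.
Context {R : realType} {k : nat} {V W : lmodType R}.
Implicit Types (f : ('I_k -> V) -> W) (Y : 'I_k -> V).

Lemma dfwithE (T : Type) (v : 'I_k -> T) j y i :
  dfwith v j y i = if i == j then y else v i.
Proof.
by case: eqVneq => [->|ij]; [rewrite dfwithin|rewrite dfwithout // eq_sym].
Qed.

Lemma dfwith_id (T : Type) (v : 'I_k -> T) j : dfwith v j (v j) = v.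
Proof. by apply/funext => i; rewrite dfwithE; case: eqP => [->|]. Qed.

Lemma multilinear_arg f Y j : multilinear f -> linear (fun y => f (dfwith Y j y)).
Proof. by move=> fM c y z; exact: fM. Qed.

Lemma multilinear0 f Y j : multilinear f -> Y j = 0 -> f Y = 0.
Proof.
move=> fM Y0; rewrite -(dfwith_id Y j) Y0.
exact: (lin0 (multilinear_arg Y j fM)).
Qed.

End Multilinear.

Section MultilinearBasis.
Context {R : realType} {k : nat} {V : vectType R}.
Local Notation e := (vbasis {:V}).
Local Notation ix := {ffun 'I_k -> 'I_(\dim {:V})}.

(** Arguments are expanded in the basis one after the other: the first [m] are
    still arbitrary and the others are basis vectors. *)
Lemma multilinear_vanish (W : lmodType R) (f : ('I_k -> V) -> W) : multilinear f ->
  (forall a : ix, f (fun j => e`_(a j)) = 0) -> forall Y, f Y = 0.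
Proof.
move=> fM f0.
suff H m : (m <= k)%N -> forall Y, (forall j : 'I_k, (m <= j)%N ->
    exists i : 'I_(\dim {:V}), Y j = e`_i) -> f Y = 0.
  by move=> Y; apply: (H k) => // j; rewrite leqNgt ltn_ord.
elim: m => [|m IH] mk Y HY.
  have [a Ya] := choice (fun j => HY j (leq0n _)).
  rewrite -(f0 [ffun j => a j]); congr f.
  by apply/funext => j; rewrite ffunE.
pose jm := Ordinal mk; have linf := multilinear_arg Y jm fM.
rewrite -(dfwith_id Y jm) (vcoordK (Y jm)) (lin_sum linf) big1 // => i _.
rewrite (linZ linf) IH ?scaler0 // ?(ltnW mk) // => j mj.
rewrite dfwithE; case: eqVneq => [_|jm']; first by exists i.
by apply: HY; rewrite ltn_neqAle mj andbT eq_sym.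
Qed.

(** Both sides are multilinear and agree on tuples of basis vectors. *)
Lemma multilinear_expand (f : ('I_k -> V) -> R^o) Y : multilinear f ->
  f Y = \sum_(a : ix) (\prod_j (vcoord (a j) (Y j) : R)) * f (fun j => e`_(a j)).
Proof.
move=> fM; apply/eqP; rewrite -subr_eq0; apply/eqP.
pose h (Z : 'I_k -> V) : R^o := f Z -
  \sum_(a : ix) (\prod_j (vcoord (a j) (Z j) : R)) * f (fun j => e`_(a j)).
apply: (@multilinear_vanish R^o h) => [Z j c y z|b]; rewrite /h.
  rewrite fM scalerBr [RHS]addrACA -opprD; congr (_ - _).
  rewrite scaler_sumr -big_split /=; apply: eq_bigr => a _.
  rewrite (bigD1 j) // [in X in _ = X + _](bigD1 j) // [in X in _ = _ + X](bigD1 j) //=.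
  rewrite !dfwithin vcoord_linear.
  rewrite [X in _ = X](_ : _ = (c * vcoord (a j) y + vcoord (a j) z) *
    \prod_(i | i != j) (vcoord (a i) (Z i) : R) * f (fun j => e`_(a j))).
    congr (_ * _ * _); apply: eq_bigr => i ij.
    by rewrite dfwithE (negPf ij).
  rewrite -![_ *: _]/(_ * _) !mulrDl !mulrA; congr (_ * _ * _ + _ * _ * _);
  by apply: eq_bigr => i ij; rewrite dfwithE (negPf ij).
have vb (i i' : 'I_(\dim {:V})) : vcoord i e`_i' = (i == i')%:R.
  have fe : free e := basis_free (vbasisP fullv).
  by rewrite /vcoord (coord_free _ _ fe) eq_sym.
rewrite (bigD1 b) //= big1 => [|j _]; last by rewrite vb eqxx.
rewrite mul1r big1 ?addr0 ?subrr // => a ab.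
have [j /negPf abj] : exists j, a j != b j.
  by apply/existsP; rewrite -negb_forall; apply: contra ab => /eqfunP/ffunP ->.
by rewrite (bigD1 j) //= vb abj !mul0r.
Qed.

End MultilinearBasis.

Section MultilinearCalculus.
Context {R : realType} {n k : nat} {V W : vectType R}.
Local Notation E := 'rV[R]_n.
Context {f : ('I_k -> V) -> W} (fM : multilinear f).

(** Induction on the number [m] of arguments which may move: [Phi y w] has the
    last moving argument replaced by the constant [w], so that the Leibniz rule
    for a linear map with a moving argument applies. *)
Lemma dirder_multilinear (Y : 'I_k -> E -> V) z : (forall j, vdiff (Y j) z) ->
  vdiff (fun y => f (Y ^~ y)) z /\
  forall v, dirder (fun y => f (Y ^~ y)) z v =
    \sum_j f (dfwith (Y ^~ z) j (dirder (Y j) z v)).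
Proof.
suff H m : (m <= k)%N -> forall Y : 'I_k -> E -> V, (forall j, vdiff (Y j) z) ->
    (forall j : 'I_k, (m <= j)%N -> exists c, Y j = fun=> c) ->
    vdiff (fun y => f (Y ^~ y)) z /\
    forall v, dirder (fun y => f (Y ^~ y)) z v =
      \sum_j f (dfwith (Y ^~ z) j (dirder (Y j) z v)).
  by move=> dY; apply: (H k) => // j; rewrite leqNgt ltn_ord.
elim: m => [|m IH] mk {}Y dY cY.
  have [c Yc] := choice (fun j => cY j (leq0n _)).
  have -> : Y = fun j => fun=> c j by apply/funext.
  split=> [|v]; first exact: vdiff_cst.
  rewrite dirder_cst big1 // => j _.
  by rewrite (multilinear0 (j := j)) // dfwithin dirder_cst.
pose jm := Ordinal mk.
pose Z w := dfwith Y jm (fun=> w).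
pose Phi y w := f (dfwith (Y ^~ y) jm w).
have PhiE w : Phi ^~ w = fun y => f ((Z w) ^~ y).
  apply/funext => y; congr f; apply/funext => j.
  by rewrite /Z !dfwithE; case: eqP.
have dZ w : (forall j, vdiff (Z w j) z).
  by move=> j; rewrite /Z dfwithE; case: eqP => // _; exact: vdiff_cst.
have cZ w (j : 'I_k) : (m <= j)%N -> exists c, Z w j = fun=> c.
  move=> mj; rewrite /Z dfwithE; case: eqVneq => [_|jm']; first by exists w.
  by apply: cY; rewrite ltn_neqAle mj andbT eq_sym.
have [||d Ed] := dirder_apply (Phi := Phi) (Y := Y jm) (z := z) _ _ (dY jm).
- by apply: near_all => y; exact: multilinear_arg.
- by move=> w; rewrite PhiE; exact: (IH (ltnW mk) _ (dZ w) (cZ w)).1.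
have PhiY : (fun y => Phi y (Y jm y)) = fun y => f (Y ^~ y).
  by apply/funext => y; rewrite /Phi (dfwith_id (Y ^~ y)).
rewrite -PhiY; split=> // v; rewrite Ed PhiE.
rewrite (IH (ltnW mk) _ (dZ _) (cZ _)).2 (bigD1 jm) //= [RHS](bigD1 jm) //=.
rewrite [X in X + _ + _](multilinear0 (j := jm)) //; last first.
  by rewrite dfwithin /Z dfwithin dirder_cst.
rewrite add0r addrC; congr (_ + _); apply: eq_bigr => j jjm.
congr f; apply/funext => i; rewrite /Z !dfwithE (negPf jjm).
by case: eqP => // _; case: eqP => [->|].
Qed.

Lemma smoothv_multilinear U (Y : 'I_k -> E -> V) : open U ->
  (forall j, smoothv U (Y j)) -> smoothv U (fun y => f (Y ^~ y)).
Proof.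
move=> oU.
suff H m : (m <= k)%N -> forall Y : 'I_k -> E -> V, (forall j, smoothv U (Y j)) ->
    (forall j : 'I_k, (m <= j)%N -> exists c, Y j = fun=> c) ->
    smoothv U (fun y => f (Y ^~ y)).
  by move=> dY; apply: (H k) => // j; rewrite leqNgt ltn_ord.
elim: m => [|m IH] mk {}Y sY cY.
  have [c Yc] := choice (fun j => cY j (leq0n _)).
  have -> : Y = fun j => fun=> c j by apply/funext.
  exact: smoothv_cst.
pose jm := Ordinal mk.
pose Z w := dfwith Y jm (fun=> w).
pose Phi y w := f (dfwith (Y ^~ y) jm w).
have -> : (fun y => f (Y ^~ y)) = fun y => Phi y (Y jm y).
  by apply/funext => y; rewrite /Phi (dfwith_id (Y ^~ y)).
apply: smoothv_apply => // [y _|w]; first exact: multilinear_arg.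
have -> : Phi ^~ w = fun y => f ((Z w) ^~ y).
  apply/funext => y; congr f; apply/funext => j.
  by rewrite /Z !dfwithE; case: eqP.
apply: IH (ltnW mk) _ _ _ => j.
  by rewrite /Z dfwithE; case: eqP => // _; exact: smoothv_cst.
move=> mj; rewrite /Z dfwithE; case: eqVneq => [_|jm']; first by exists w.
by apply: cY; rewrite ltn_neqAle mj andbT eq_sym.
Qed.

End MultilinearCalculus.

(** * Alternation over pairs of arguments *)

Section Pairs.
Context {k : nat}.

Fact pairpos_subproof (j : 'I_k) (c : 'I_2) : (j.*2 + c < k.*2)%N.
Proof. by have := ltn_ord j; have := ltn_ord c; rewrite -!addnn; lia. Qed.

(** Position [c] of the [j]-th of the [k] pairs into which [2k] arguments are
    grouped. *)
Definition pairpos j c : 'I_(k.*2) := Ordinal (pairpos_subproof j c).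

Lemma pairpos_eq i j b c : (pairpos i b == pairpos j c) = (i == j) && (b == c).
Proof.
rewrite -!val_eqE /=; have := ltn_ord b; have := ltn_ord c; rewrite -!addnn.
by move=> b2 c2; apply/idP/idP => [|/andP[]]; lia.
Qed.

Lemma pairposP (b : 'I_(k.*2)) : exists j c, b = pairpos j c.
Proof.
have hb := ltn_ord b.
have hj : (b./2 < k)%N by move: (nat_of_ord b) hb => m; rewrite -addnn; lia.
have hc : (b %% 2 < 2)%N by rewrite ltn_mod.
exists (Ordinal hj), (Ordinal hc); apply: val_inj => /=.
by rewrite modn2 addnC odd_double_half.
Qed.

Lemma ord2P (c : 'I_2) : c = ord0 \/ c = ord_max.
Proof. by case: c => [[|[|//]] h]; [left|right]; apply: val_inj. Qed.

Definition pairs (T V : Type) (B : ('I_2 -> T) -> V) (w : 'I_(k.*2) -> T) : 'I_k -> V :=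
  fun j => B (fun c => w (pairpos j c)).

(** Changing one of the [2k] arguments changes one of the [k] pairs. *)
Lemma pairs_dfwith (T V : Type) (B : ('I_2 -> T) -> V) (v : 'I_(k.*2) -> T)
    (s : 'S_(k.*2)) j c y :
  pairs B (dfwith v (s (pairpos j c)) y \o s) =
  dfwith (pairs B (v \o s)) j (B (dfwith (fun d => v (s (pairpos j d))) c y)).
Proof.
apply/funext => i; rewrite [RHS]dfwithE /pairs.
case: eqP => [->|ij]; congr B; apply/funext => d; rewrite /= !dfwithE.
  by rewrite (inj_eq perm_inj) pairpos_eq eqxx.
by rewrite (inj_eq perm_inj) pairpos_eq; case: eqP ij.
Qed.

End Pairs.

Lemma pairpos_lift k (j : 'I_k) (c : 'I_2) :
  pairpos (lift ord0 j) c = lift ord0 (lift ord0 (pairpos j c)).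
Proof. by apply: val_inj; rewrite /= /bump /= doubleS. Qed.

Lemma sum_pairpos (R : nmodType) k (F : 'I_(k.*2) -> R) :
  \sum_b F b = \sum_j (F (pairpos j ord0) + F (pairpos j ord_max)).
Proof.
elim: k F => [|k IH] F; first by rewrite !big_ord0.
rewrite [RHS]big_ord_recl; under [in RHS]eq_bigr do rewrite !pairpos_lift.
rewrite -(IH (fun b => F (lift ord0 (lift ord0 b)))).
rewrite [LHS](@big_ord_recl _ _ _ (k.*2).+1) big_ord_recl addrA.
congr (_ + _ + _); congr F; exact: val_inj.
Qed.

Section AlternatedPairs.
Context {R : realType} {k : nat} {T V : lmodType R}.
Implicit Types (f : ('I_k -> V) -> R^o) (B : ('I_2 -> T) -> V) (v : 'I_(k.*2) -> T).

(** The closed formula for [f^Omega] when [B] is the value of [Omega] at a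
    point. *)
Definition alt_pairs f B v : R^o :=
  (2^-1) ^+ k *: \sum_(s : 'S_(k.*2)) ((-1) ^+ s : R) *: f (pairs B (v \o s)).

Lemma alt_pairs_multilinear f B : multilinear f -> multilinear B ->
  multilinear (alt_pairs f B).
Proof.
move=> fM BM v a c y z; rewrite /alt_pairs scalerA [c * _]mulrC -scalerA -scalerDr.
congr (_ *: _); rewrite scaler_sumr -big_split /=; apply: eq_bigr => s _.
(* Under [s], the argument [a] is seen by exactly one pair. *)
have [j [d jd]] := pairposP (s^-1%g a).
have -> : a = s (pairpos j d) by rewrite -jd permKV.
by rewrite !pairs_dfwith BM fM scalerDr !scalerA mulrC.
Qed.

(** Transposing two equal arguments changes the sign of every summand. *)
Lemma alt_pairs_alternating f B : alternating_map (alt_pairs f B).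
Proof.
move=> v a b ab vab; rewrite /alt_pairs.
set S := \sum_s _; suff S0 : S = 0 by rewrite S0 scaler0.
have : S = - S.
  rewrite {1}/S (reindex_inj (@mulIg _ (tperm a b))) /= -sumrN.
  apply: eq_bigr => s _; rewrite odd_permM odd_tperm ab addbT signrN scaleNr.
  congr (- (_ *: f _)); apply/funext => j; congr B; apply/funext => c.
  by rewrite /= permM; case: tpermP => [->|->|].
by move/eqP; rewrite -addr_eq0 -mulr2n -scaler_nat scaler_eq0 pnatr_eq0 /= => /eqP.
Qed.

(** Every permutation puts the argument [v a] into some pair, on which [B]
    vanishes. *)
Lemma alt_pairs_eq0 f B v a : multilinear f ->
  (forall w, (exists c, w c = v a) -> B w = 0) -> alt_pairs f B v = 0.
Proof.
move=> fM B0; rewrite /alt_pairs big1 ?scaler0 // => s _.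
have [j [d jd]] := pairposP (s^-1%g a).
rewrite (multilinear0 (j := j)) ?scaler0 //; apply: B0; exists d.
by rewrite /= -jd permKV.
Qed.

End AlternatedPairs.

(** * The iterated wedge product *)

Section WedgePower.
Context {R : realType} {n : nat} {M : manifold R n} {g : lieAlgebra R}.
Implicit Types Phi : dform M 2 g.

(** The action of ['S_m] on the last [m] of [m + 2] positions, through which the
    alternation of the inner wedge product is absorbed by the outer one. *)
Definition perm_after_pair m (t : 'S_m) : 'S_m.+2 :=
  lift_perm ord0 ord0 (lift_perm ord0 ord0 t).

Lemma perm_after_pair_fix k (t : 'S_(k.*2)) (c : 'I_2) :
  perm_after_pair t (pairpos (ord0 : 'I_k.+1) c) = pairpos (ord0 : 'I_k.+1) c.
Proof.
have [->|->] := ord2P c.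
  have -> : pairpos (ord0 : 'I_k.+1) ord0 = ord0 :> 'I_(k.*2).+2 by exact: val_inj.
  exact: lift_perm_id.
have -> : pairpos (ord0 : 'I_k.+1) ord_max = lift ord0 ord0 :> 'I_(k.*2).+2.
  exact: val_inj.
by rewrite /perm_after_pair lift_perm_lift lift_perm_id.
Qed.

Lemma perm_after_pair_lift m (t : 'S_m) b :
  perm_after_pair t (lift ord0 (lift ord0 b)) = lift ord0 (lift ord0 (t b)).
Proof. by rewrite /perm_after_pair !lift_perm_lift. Qed.

Lemma odd_perm_after_pair m (t : 'S_m) : perm_after_pair t = t :> bool.
Proof. by rewrite /perm_after_pair !odd_lift_perm /=. Qed.

(** Each permutation [r] of the new positions arises from [(2k)!] pairs of an
    outer permutation [s] and an inner one [t], as the composite of [s] and of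
    the extension of [t]. The normalisation [2! (2k)!] of the wedge product thus
    leaves a factor [1/2] for each curvature factor. *)
Lemma wedge_power_entry Phi k x v (a : {ffun 'I_k -> 'I_(\dim {:g})}) :
  wedge_power Phi k x v a = (2^-1) ^+ k * \sum_(s : 'S_(k.*2))
    ((-1) ^+ s * \prod_j (vcoord (a j) (pairs (Phi x) (v \o s) j) : R)) :> R.
Proof.
elim: k v a => [|k IH] v a.
  rewrite ffunE (big_pred1 1%g) => [|s]; last by rewrite /= (permS0 s) eqxx.
  by rewrite odd_perm1 big_ord0 !mulr1.
have regroup (p q r u w : R) : p * q * r * (u * w) = r * ((p * u) * (q * w)) by ring.
pose S : R := \sum_(s : 'S_(k.+1.*2))
  ((-1) ^+ s * \prod_j (vcoord (a j) (pairs (Phi x) (v \o s) j) : R)).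
pose G (s : 'S_(k.+1.*2)) : R :=
  (-1) ^+ s * \prod_j (vcoord (a j) (pairs (Phi x) (v \o s) j) : R).
rewrite -/S /= /wedge_prod ffunE sum_ffunE.
have -> : \sum_(s : 'S_(2 + k.*2)) ((-1) ^+ s *: tensor
      (Phi x (fun c => v (s (lshift k.*2 c))))
      (wedge_power Phi k x (fun b => v (s (rshift 2 b))))) a =
    (2^-1) ^+ k * ((k.*2)`!%:R * S) :> R.
  transitivity (\sum_(s : 'S_(k.+1.*2)) \sum_(t : 'S_(k.*2))
      (2^-1) ^+ k * G (perm_after_pair t * s)%g).
    apply: eq_bigr => s _; rewrite !ffunE IH.
    rewrite /= -[_ *: _]/(_ * _) !mulrA mulr_sumr; apply: eq_bigr => t _.
    rewrite /G odd_permM odd_perm_after_pair signr_addb big_ord_recl.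
    pose r : 'S_(k.+1.*2) := (perm_after_pair t * s)%g; rewrite -/r.
    have -> : pairs (Phi x) (v \o r) ord0 =
        Phi x (fun c => v (s (lshift k.*2 c))).
      rewrite /pairs; congr (Phi x _); apply/funext => c /=.
      by rewrite /r permM perm_after_pair_fix; congr (v (s _)); apply: val_inj.
    have -> : \prod_(j < k) (vcoord (a (lift ord0 j)) (pairs (Phi x)
          (v \o r) (lift ord0 j)) : R) =
        \prod_(j < k) (vcoord ([ffun j => a (lift ord0 j)] j)
          (pairs (Phi x) ((fun b => v (s (rshift 2 b))) \o t) j) : R).
      apply: eq_bigr => j _; rewrite ffunE; congr (vcoord _ (Phi x _)).
      apply/funext => c; rewrite /= /r permM pairpos_lift perm_after_pair_lift.
      by congr (v (s _)); apply: val_inj.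
    rewrite [X in _ = _ * (X * _)]mulrC; exact: regroup.
  rewrite exchange_big /= (eq_bigr (fun=> (2^-1) ^+ k * S)) => [|t _].
    by rewrite sumr_const card_Sn [RHS]mulrCA mulr_natl.
  apply: etrans (esym (mulr_sumr _ _ _ _)) _; congr (_ * _).
  by rewrite /S [RHS](reindex_inj (mulgI (perm_after_pair t))).
rewrite -[_ *: _]/(_ * _) exprS natrM (_ : 2`! = 2)%N //.
have m0 : (k.*2)`!%:R != 0 :> R by rewrite pnatr_eq0 -lt0n fact_gt0.
by move: ((k.*2)`!%:R : R) ((2^-1) ^+ k : R) S m0 => m c S1 m0; field.
Qed.


Lemma form_of_alt_pairs k (f : ('I_k -> g) -> R) Phi x v :
  multilinear (f : _ -> R^o) ->
  form_of f Phi x v = alt_pairs (f : _ -> R^o) (Phi x) v.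
Proof.
move=> fM; rewrite /form_of /tensor_lift /alt_pairs.
under eq_bigr do rewrite wedge_power_entry -mulrA mulr_suml.
rewrite -mulr_sumr exchange_big /=; congr (_ * _); apply: eq_bigr => s _.
rewrite (multilinear_expand _ fM) scaler_sumr; apply: eq_bigr => a _.
by rewrite -mulrA.
Qed.

End WedgePower.

(** * Finite sums of vector-valued maps *)

Section Sums.
Context {R : realType} {n : nat}.
Local Notation E := 'rV[R]_n.

Lemma dirder_sum (V : vectType R) I (r : seq I) (F : I -> E -> V) z :
  (forall i, vdiff (F i) z) ->
  vdiff (fun y => \sum_(i <- r) F i y) z /\
  forall v, dirder (fun y => \sum_(i <- r) F i y) z v = \sum_(i <- r) dirder (F i) z v.
Proof.
move=> dF; elim: r => [|i r [dr Er]].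
  have -> : (fun y => \sum_(i <- [::]) F i y) = fun=> 0.
    by apply/funext => y; rewrite big_nil.
  by split=> [|v]; [exact: vdiff_cst|rewrite dirder_cst big_nil].
have -> : (fun y => \sum_(j <- i :: r) F j y) = fun y => F i y + \sum_(j <- r) F j y.
  by apply/funext => y; rewrite big_cons.
by split=> [|v]; [exact: vdiffD|rewrite dirderD // Er big_cons].
Qed.

Lemma smoothv_sum (V : vectType R) (U : set E) I (r : seq I) (F : I -> E -> V) :
  open U -> (forall i, smoothv U (F i)) -> smoothv U (fun y => \sum_(i <- r) F i y).
Proof.
move=> oU sF; elim: r => [|i r IH].
  by apply: (smoothv_ext oU _ (smoothv_cst U 0)) => y _; rewrite big_nil.
by apply: (smoothv_ext oU _ (smoothvD oU (sF i) IH)) => y _; rewrite big_cons.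
Qed.

End Sums.

(** * Sums over permutations *)

Section PermutationSums.
Context {R : realType}.

(** A permutation of [m + 1] positions is the choice of the image [a] of the first
    one and a bijection of the other positions onto the complement of [a]; the
    sum over [a] is the one in the exterior derivative. *)
Lemma sum_lift_perm (W : nmodType) m (F : 'S_m.+1 -> W) :
  \sum_(a < m.+1) \sum_(s : 'S_m) F (lift_perm ord0 a s) = \sum_(r : 'S_m.+1) F r.
Proof.
rewrite pair_big /=; pose h (p : 'I_m.+1 * 'S_m) := lift_perm ord0 p.1 p.2.
have h_inj : injective h.
  move=> [a s] [b t] /permP hst.
  have ab : a = b by have := hst ord0; rewrite /h !lift_perm_id.
  congr pair; first exact: ab.
  apply/permP => i; have := hst (lift ord0 i).
  by rewrite /h !lift_perm_lift ab => /lift_inj.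
rewrite [RHS](reindex h) //; apply/onW_bij/inj_card_bij => //.
by rewrite card_prod !card_Sn card_ord factS.
Qed.

(** The 3-cycle of the positions [p], [q], [r] is even and preserves [P], so
    that reindexing by it rotates the arguments of [F]; the sum of the three
    rotated copies is an alternated sum of cyclic sums. *)
Lemma sum_cycle3 m (V W : lmodType R) (p q r : 'I_m) (F : 'I_m -> 'I_m -> 'I_m -> V)
    (P : 'S_m -> V -> W) : p != q -> p != r -> q != r ->
  (forall s, linear (P s)) ->
  (forall c s : 'S_m, (forall i, i != p -> i != q -> i != r -> c i = i) ->
     P (c * s)%g = P s) ->
  (forall a b c, F a b c + F b c a + F c a b = 0) ->
  \sum_(s : 'S_m) ((-1) ^+ s : R) *: P s (F (s p) (s q) (s r)) = 0.
Proof.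
move=> pq pr qr linP PC F0; set S := \sum_s _.
pose c := (tperm p q * tperm p r)%g : 'S_m.
have cp : c p = q by rewrite permM tpermL tpermD // eq_sym.
have cq : c q = r by rewrite permM tpermR tpermL.
have cr : c r = p by rewrite permM [tperm p q r]tpermD ?tpermR // eq_sym.
have oc : c = false :> bool by rewrite odd_permM !odd_tperm pq pr.
have cfix i : i != p -> i != q -> i != r -> c i = i.
  by move=> ip iq ir; rewrite permM !tpermD // eq_sym.
have shift (a b d : 'I_m) : \sum_(s : 'S_m) ((-1) ^+ s : R) *: P s (F (s a) (s b) (s d)) =
    \sum_(s : 'S_m) ((-1) ^+ s : R) *: P s (F (s (c a)) (s (c b)) (s (c d))).
  rewrite (reindex_inj (mulgI c)); apply: eq_bigr => s _ /=.
  by rewrite odd_permM oc PC // !permM.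
have S1 : S = \sum_(s : 'S_m) ((-1) ^+ s : R) *: P s (F (s q) (s r) (s p)).
  by apply: etrans (shift p q r) _; rewrite cp cq cr.
have S2 : S = \sum_(s : 'S_m) ((-1) ^+ s : R) *: P s (F (s r) (s p) (s q)).
  by rewrite S1; apply: etrans (shift q r p) _; rewrite cp cq cr.
have : S + S + S = 0.
  rewrite {2}S1 {2}S2 -!big_split /= big1 // => s _.
  by rewrite -!scalerDr -!(linD (linP s)) F0 (lin0 (linP s)) scaler0.
rewrite (_ : S + S + S = (3%:R : R) *: S); last first.
  by rewrite scaler_nat !mulrS mulr0n addr0 addrA.
move/eqP; by rewrite scaler_eq0 pnatr_eq0 /= => /eqP.
Qed.

End PermutationSums.

(** * Closedness and invariance in a chart *)

Section LocalChernWeil.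
Context {R : realType} {n k : nat} {g : lieAlgebra R}.
Local Notation E := 'rV[R]_n.
Local Notation br := (@lie_br R g).
Context {f : ('I_k -> g) -> R^o} (fM : multilinear f).

Lemma dirder_alt_pairs (B : E -> ('I_2 -> E) -> g) v z :
  (forall w, vdiff (B ^~ w) z) ->
  forall u, dirder (fun y => alt_pairs f (B y) v) z u =
  (2^-1) ^+ k *: \sum_(s : 'S_(k.*2)) ((-1) ^+ s : R) *:
    \sum_j f (dfwith (pairs (B z) (v \o s)) j
                (dirder (fun y => pairs (B y) (v \o s) j) z u)).
Proof.
move=> dB u.
have dP (s : 'S_(k.*2)) j : vdiff (fun y => pairs (B y) (v \o s) j) z by exact: dB.
have d1 (s : 'S_(k.*2)) := dirder_multilinear fM (dP s).
have d2 (s : 'S_(k.*2)) := vdiff_lin (scale_linear ((-1) ^+ s : R)) (d1 s).1.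
have [d3 E3] := dirder_sum (index_enum _) d2.
rewrite (dirder_lin _ (scale_linear _) d3) E3; congr (_ *: _).
apply: eq_bigr => s _.
by rewrite (dirder_lin _ (scale_linear _) (d1 s).1) (d1 s).2.
Qed.

Lemma smoothv_alt_pairs (U : set E) (B : E -> ('I_2 -> E) -> g) v : open U ->
  (forall w, smoothv U (B ^~ w)) -> smoothv U (fun y => alt_pairs f (B y) v).
Proof.
move=> oU sB; apply: (smoothv_lin oU (scale_linear ((2^-1) ^+ k : R))).
apply: smoothv_sum => // s; apply: (smoothv_lin oU (scale_linear ((-1) ^+ s : R))).
by apply: (smoothv_multilinear fM) => // j; exact: sB.
Qed.

Hypothesis fI : forall (X : g) (Y : 'I_k -> g),
  \sum_(a < k) f (dfwith Y a (br X (Y a))) = 0.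

Definition loc_curv_form (A : E -> E -> g) z (w : 'I_2 -> E) : g :=
  loc_curv A z (w ord0) (w ord_max).

Context {U : set E} {A : E -> E -> g}.
Hypotheses (oU : open U) (linA : forall z, U z -> linear (A z)).
Hypothesis (smA : forall v, smoothv U (A ^~ v)).
Local Notation K := (loc_curv_form A).

Lemma loc_curv_form_multilinear z : U z -> multilinear (K z).
Proof.
move=> Uz w a c x y; rewrite /loc_curv_form !dfwithE.
have [->|->] := ord2P a; rewrite ?eqxx -?val_eqE /=.
  exact: (loc_curv_linearl oU linA smA).
exact: (loc_curv_linearr oU linA smA).
Qed.

Lemma smoothv_loc_curv_form w : smoothv U (K ^~ w).
Proof. exact: (smoothv_loc_curv oU smA). Qed.

(** Invariance of [f] replaces each derivative of the curvature by its covariant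
    derivative; alternation then produces the cyclic sums of the Bianchi
    identity. *)
Lemma loc_chern_weil_closed z (v : 'I_(k.*2).+1 -> E) : U z ->
  \sum_(a < (k.*2).+1) ((-1) ^+ a : R) *:
    dirder (fun y => alt_pairs f (K y) (fun b => v (lift a b))) z (v a) = 0.
Proof.
move=> Uz; have dK w : vdiff (K ^~ w) z.
  exact: smoothv_vdiff (smoothv_loc_curv_form w) Uz.
pose T a b c := dirder (fun y => loc_curv A y (v b) (v c)) z (v a) +
  br (A z (v a)) (loc_curv A z (v b) (v c)).
pose w (r : 'S_(k.*2).+1) b := v (r (lift ord0 b)).
pose P (r : 'S_(k.*2).+1) j X := f (dfwith (pairs (K z) (w r)) j X).
pose p := lift ord0 \o (pairpos ^~ ord0 : 'I_k -> _).
pose q := lift ord0 \o (pairpos ^~ ord_max : 'I_k -> _).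
transitivity ((2^-1 : R) ^+ k *: \sum_(r : 'S_(k.*2).+1) ((-1) ^+ r : R) *:
    \sum_j P r j (T (r ord0) (r (p j)) (r (q j)))).
  (* The [a]-th term of the exterior derivative and the permutation [s] of the
     other arguments combine into [lift_perm ord0 a s], whose first position
     carries the direction of differentiation. *)
  rewrite -sum_lift_perm scaler_sumr; apply: eq_bigr => a _.
  rewrite dirder_alt_pairs // scalerA mulrC -scalerA; congr (_ *: _).
  rewrite scaler_sumr; apply: eq_bigr => s _; rewrite scalerA; congr (_ *: _).
    by rewrite odd_lift_perm /= signr_addb signr_odd.
  set r := lift_perm ord0 a s.
  have wr : w r = (fun b => v (lift a b)) \o s.
    by apply/funext => b; rewrite /w /r lift_perm_lift.
  have r0 : r ord0 = a by rewrite /r lift_perm_id.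
  rewrite -wr /P; under [RHS]eq_bigr do rewrite (linD (multilinear_arg _ _ fM)).
  rewrite big_split /= [X in _ = _ + X](_ : _ = 0) ?addr0.
    by apply: eq_bigr => j _; rewrite r0.
  exact: (fI (A z (v (r ord0))) (pairs (K z) (w r))).
rewrite (eq_bigr (fun r : 'S_(k.*2).+1 => \sum_j ((-1) ^+ r : R) *:
  P r j (T (r ord0) (r (p j)) (r (q j))))) => [|r _]; last by rewrite scaler_sumr.
rewrite exchange_big /= big1 ?scaler0 // => j _.
apply: (@sum_cycle3 _ _ _ _ _ _ _ T (fun r => P r j)) => //.
- by rewrite /p /q (inj_eq lift_inj) pairpos_eq eqxx.
- by move=> r; exact: multilinear_arg.
- move=> c r cfix; apply/funext => X; congr f; apply/funext => i.
  rewrite !dfwithE; case: eqVneq => [_|ij]; first by [].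
  rewrite /pairs; congr (K z _); apply/funext => d.
  by rewrite /w permM cfix // (inj_eq lift_inj) pairpos_eq (negPf ij).
- by move=> a b c; exact: (loc_bianchi oU smA).
Qed.

(** For a fixed permutation, the terms in which the field is differentiated are
    sorted by the pair which they hit; each pair then contributes the Lie
    derivative of the curvature. *)
Lemma loc_chern_weil_invariant (X : E -> E) (X0 : g) z (v : 'I_(k.*2) -> E) : U z ->
  (forall u w, dirder (fun y => loc_curv A y u w) z (X z) +
     loc_curv A z (dirder X z u) w + loc_curv A z u (dirder X z w) =
     - br X0 (loc_curv A z u w)) ->
  dirder (fun y => alt_pairs f (K y) v) z (X z) +
  \sum_(a < k.*2) alt_pairs f (K z) (dfwith v a (dirder X z (v a))) = 0.
Proof.
move=> Uz LK; have dK w : vdiff (K ^~ w) z.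
  exact: smoothv_vdiff (smoothv_loc_curv_form w) Uz.
rewrite dirder_alt_pairs // /alt_pairs -scaler_sumr -scalerDr.
rewrite exchange_big /= -big_split /= big1 ?scaler0 // => s _.
rewrite -scaler_sumr -scalerDr (reindex_inj (@perm_inj _ s)) sum_pairpos.
rewrite -big_split /= (eq_bigr (fun j => - f (dfwith (pairs (K z) (v \o s)) j
  (br X0 (pairs (K z) (v \o s) j))))) => [|j _].
  by rewrite sumrN fI oppr0 scaler0.
have linf := multilinear_arg (pairs (K z) (v \o s)) j fM.
have linf3 x y w : f (dfwith (pairs (K z) (v \o s)) j (x + y + w)) =
    f (dfwith (pairs (K z) (v \o s)) j x) +
    (f (dfwith (pairs (K z) (v \o s)) j y) + f (dfwith (pairs (K z) (v \o s)) j w)).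
  by rewrite 2!(linD linf) addrA.
rewrite !pairs_dfwith -(linN linf) -LK; apply: etrans _ (esym (linf3 _ _ _)).
congr (_ + (f (dfwith _ _ _) + f (dfwith _ _ _)));
by rewrite /loc_curv_form !dfwithE.
Qed.

End LocalChernWeil.

(** * Forms and vector fields in charts *)

Section Charts.
Context {R : realType} {n : nat} {M : manifold R n}.
Local Notation E := 'rV[R]_n.
Implicit Types (i j l : chart M) (x : M) (z u v : E).

Lemma param_dom i z : img i z -> chart_dom i (param i z).
Proof. by move=> [x xi <-]; rewrite coordsK. Qed.

Lemma paramK i z : img i z -> coords i (param i z) = z.
Proof. by move=> [x xi <-]; rewrite coordsK. Qed.

Lemma coords_img i x : chart_dom i x -> img i (coords i x).
Proof. by move=> xi; exists x. Qed.

Lemma open_img i : open (img i).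
Proof. exact: img_open. Qed.

Definition overlap i j : set E := coords i @` (chart_dom i `&` chart_dom j).

Lemma overlapP i j z : overlap i j z <-> img i z /\ chart_dom j (param i z).
Proof.
split=> [[x [xi xj] <-]|[zi zj]].
  by rewrite coordsK //; split=> //; exact: coords_img.
by exists (param i z); [split=> //; exact: param_dom|exact: paramK].
Qed.

Lemma overlap_coords i j x : chart_dom i x -> chart_dom j x -> overlap i j (coords i x).
Proof. by move=> xi xj; exists x. Qed.

Lemma overlap_open i j : open (overlap i j).
Proof.
rewrite openE => z /overlapP [zi zj].
have c := param_continuous zi.
have : nbhs z (img i `&` param i @^-1` chart_dom j).
  apply: filterI; first by apply: open_nbhs_nbhs; split=> //; exact: open_img.
  by apply: c; apply: open_nbhs_nbhs; split=> //; exact: chart_dom_open.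
by apply: filterS => y [yi yj]; apply/overlapP.
Qed.

Arguments open_img : clear implicits.
Arguments overlap_open : clear implicits.

(** The differential of the transition map from chart [i] to chart [j]. *)
Definition dtrans i j z v : E := 'D_v (coords j \o param i) z.

Lemma trans_differentiable i j z : overlap i j z ->
  differentiable (coords j \o param i) z.
Proof. exact: smooth_differentiable (transition_smooth i j). Qed.

Lemma dtrans_linear i j z : overlap i j z -> linear (dtrans i j z).
Proof.
move=> /trans_differentiable d c u v.
by rewrite /dtrans !(deriveE _ d); exact: linearP.
Qed.

Lemma dtrans_comp i j l z v : overlap i j z -> overlap i l z ->
  dtrans i l z v = dtrans j l (coords j (param i z)) (dtrans i j z v).
Proof.
move=> zj zl; have [zi xj] := (overlapP _ _ _).1 zj; have [_ xl] := (overlapP _ _ _).1 zl.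
have dj := trans_differentiable zj.
have dl : differentiable (coords l \o param j) ((coords j \o param i) z).
  by apply: trans_differentiable; exact: overlap_coords.
rewrite /dtrans (deriveE _ dl) (deriveE v dj).
rewrite -[RHS]/(('d _ _ \o 'd _ _) v) -(diff_comp dj dl).
rewrite -deriveE; last exact: differentiable_comp.
apply: near_eq_derive; apply: (open_near (overlap_open i j) zj) => y yj.
by have [yi xyj] := (overlapP _ _ _).1 yj; rewrite /= coordsK.
Qed.

Lemma dtrans_id i z v : img i z -> dtrans i i z v = v.
Proof.
move=> zi; rewrite -[RHS](derive_id z v); apply: near_eq_derive.
by apply: (open_near (open_img i) zi) => y yi; rewrite /= paramK.
Qed.

(** Tangent spaces at equal points are equal only as types of vectors, all of them
    being ['rV_n]; the arguments are kept outside the dependent type. *)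
Lemma dform_transport p (V : vectType R) (phi : dform M p V) x y (v : 'I_p -> E) :
  x = y -> phi x v = phi y v.
Proof. by move=> ->. Qed.

Lemma form_localE p (V : vectType R) (phi : dform M p V) i z (w : 'I_p -> E) : img i z ->
  form_local phi i z w =
  phi (param i z) (fun a => dtrans i (chart_at (param i z)) z (w a)).
Proof.
move=> zi; rewrite /form_local; congr (phi _ _); apply/funext => a.
by rewrite /vect_of paramK.
Qed.

Lemma form_local_at p (V : vectType R) (phi : dform M p V) x (w : 'I_p -> E) :
  form_local phi (chart_at x) (coords (chart_at x) x) w = phi x w.
Proof.
have xi := chart_at_dom x; have zi := coords_img xi.
rewrite form_localE //; have xE := coordsK xi.
rewrite (_ : (fun a => _) = w); first exact: dform_transport.
by apply/funext => a; rewrite xE dtrans_id.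
Qed.

(** Local expressions in two charts are related by pullback along the transition
    map. *)
Lemma form_local_trans p (V : vectType R) (phi : dform M p V) i j z (w : 'I_p -> E) :
  overlap i j z ->
  form_local phi i z w =
  form_local phi j (coords j (param i z)) (fun a => dtrans i j z (w a)).
Proof.
move=> zj; have [zi xj] := (overlapP _ _ _).1 zj.
have xE := coordsK xj; have yj := coords_img xj.
have xc := chart_at_dom (param i z).
rewrite !form_localE // (dform_transport phi _ (esym xE)) xE; congr (phi _ _).
apply/funext => a; apply: dtrans_comp => //; exact/overlapP.
Qed.

Lemma vf_localE (X : vector_field M) i x : chart_dom i x ->
  vf_local X i (coords i x) =
  dtrans (chart_at x) i (coords (chart_at x) x) (X x).
Proof. by move=> xi; rewrite /vf_local coordsK. Qed.

Lemma vf_local_at (X : vector_field M) x :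
  vf_local X (chart_at x) (coords (chart_at x) x) = X x.
Proof.
have xi := chart_at_dom x; rewrite vf_localE // dtrans_id //.
exact: coords_img.
Qed.

Lemma vf_local_trans (X : vector_field M) i j z : overlap i j z ->
  vf_local X j (coords j (param i z)) = dtrans i j z (vf_local X i z).
Proof.
move=> zj; have [zi xj] := (overlapP _ _ _).1 zj.
have xi := param_dom zi; have xc := chart_at_dom (param i z).
have -> : vf_local X i z = dtrans (chart_at (param i z)) i
    (coords (chart_at (param i z)) (param i z)) (X (param i z)).
  by rewrite -{1}(paramK zi) vf_localE.
rewrite vf_localE //.
rewrite (dtrans_comp (j := i)) ?coordsK ?paramK //; exact: overlap_coords.
Qed.

Section Transition.
Context {i j : chart M} {z : E} (zj : overlap i j z).
Local Notation t := (coords j \o param i).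

Lemma vdiff_dtrans v : vdiff (fun y => dtrans i j y v) z.
Proof.
apply: differentiable_vdiff; apply: smooth_differentiable zj.
by apply: smooth_derive; exact: transition_smooth.
Qed.

Lemma dirder_dtrans_comm u v :
  dirder (fun y => dtrans i j y v) z u = dirder (fun y => dtrans i j y u) z v.
Proof.
have oU := overlap_open i j.
have st : smoothv (overlap i j) t.
  by apply: smooth_smoothv => //; exact: transition_smooth.
have E w w' : dirder (fun y => dtrans i j y w) z w' =
    dirder (fun y => dirder t y w) z w'.
  apply: near_eq_dirder; apply: (open_near oU zj) => y yj.
  by rewrite dirder_derive //; exact: trans_differentiable.
by rewrite !E; exact: (dirder_comm _ _ oU st zj).
Qed.

End Transition.

Section OneForms.
Context {V : vectType R} (phi : dform M 1 V).

Definition one_form_local i z v : V := form_local phi i z (fun=> v).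
Local Notation A := one_form_local.

Lemma one_form_local_trans i j z v : overlap i j z ->
  A i z v = A j (coords j (param i z)) (dtrans i j z v).
Proof. exact: form_local_trans. Qed.

Lemma one_form_local_at x v : A (chart_at x) (coords (chart_at x) x) v = @phi x (fun=> v).
Proof. exact: form_local_at. Qed.

Hypothesis phiP : is_dform phi.

Lemma one_form_local_linear i z : img i z -> linear (A i z).
Proof.
move=> zi c u v; have [phiM _ _] := phiP.
have phi_lin x : linear (fun w : E => @phi x (fun=> w)).
  move=> d w w'; have E1 (y : E) : (fun=> y) = dfwith (fun=> 0) (ord0 : 'I_1) y.
    by apply/funext => a; rewrite dfwithE ord1.
  by rewrite (E1 (d *: w + w')) (E1 w) (E1 w'); exact: phiM.
rewrite /one_form_local !form_localE // dtrans_linear; first exact: phi_lin.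
by apply/overlapP; split=> //; exact: chart_at_dom.
Qed.

Lemma one_form_local_smooth i v : smoothv (img i) (fun z => A i z v).
Proof. by have [_ _] := phiP; exact. Qed.

(** The chain rule and the Leibniz rule for the pulled back 1-form; the last
    term is the one which prevents a plain derivative from being tensorial. *)
Lemma dirder_one_form_trans i j z u v : overlap i j z ->
  dirder (fun y => A i y v) z u =
  dirder (fun y => A j y (dtrans i j z v)) (coords j (param i z)) (dtrans i j z u) +
  A j (coords j (param i z)) (dirder (fun y => dtrans i j y v) z u).
Proof.
move=> zj; have [zi xj] := (overlapP _ _ _).1 zj; have yj := coords_img xj.
have dt := trans_differentiable zj.
have dA w : vdiff (fun y => A j y w) ((coords j \o param i) z).
  exact: smoothv_vdiff (one_form_local_smooth j w) yj.
have dAt w := dirder_comp u dt (dA w).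
have [|w|_ E] := @dirder_apply _ _ _ _ (fun y => A j (coords j (param i y)))
  (fun y => dtrans i j y v) z _ _ (vdiff_dtrans zj v).
- apply: (open_near (overlap_open i j) zj) => y /overlapP [yi xyj].
  by apply: one_form_local_linear; exact: coords_img.
- exact: (dAt w).1.
rewrite -(dAt _).2 -E; apply: near_eq_dirder.
apply: (open_near (overlap_open i j) zj) => y; exact: one_form_local_trans.
Qed.

(** The exterior derivative of a 1-form does not depend on the chart: the terms
    with second derivatives of the transition map cancel by symmetry. *)
Lemma loc_d_trans i j z u v : overlap i j z ->
  loc_d (A i) z u v =
  loc_d (A j) (coords j (param i z)) (dtrans i j z u) (dtrans i j z v).
Proof.
move=> zj; have cancel (a b c : V) : (a + c) - (b + c) = a - b.
  by rewrite opprD addrACA subrr addr0.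
rewrite /loc_d (dirder_one_form_trans u v zj) (dirder_one_form_trans v u zj).
rewrite (dirder_dtrans_comm zj u v); exact: cancel.
Qed.

Lemma ext_d_at x (w : 'I_2 -> E) : ext_d phi x w =
  loc_d (A (chart_at x)) (coords (chart_at x) x) (w ord0) (w ord_max).
Proof.
have E0 : (fun b : 'I_1 => w (lift ord0 b)) = fun=> w ord_max.
  by apply/funext => b; rewrite (ord1 b); congr w; exact: val_inj.
have E1 : (fun b : 'I_1 => w (lift ord_max b)) = fun=> w ord0.
  by apply/funext => b; rewrite (ord1 b); congr w; exact: val_inj.
rewrite /ext_d big_ord_recl big_ord1.
rewrite (_ : lift ord0 ord0 = ord_max :> 'I_2); last exact: val_inj.
by rewrite E0 E1 expr0 scale1r expr1 scaleN1r.
Qed.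

Lemma form_local_ext_d i z (w : 'I_2 -> E) : img i z ->
  form_local (ext_d phi) i z w = loc_d (A i) z (w ord0) (w ord_max).
Proof.
move=> zi; rewrite form_localE // ext_d_at; symmetry; apply: loc_d_trans.
by apply/overlapP; split=> //; exact: chart_at_dom.
Qed.

Definition loc_lie (X : vector_field M) i z v : V :=
  dirder (fun y => A i y v) z (vf_local X i z) + A i z (dirder (vf_local X i) z v).

(** The second derivatives of the transition map which come from the form and
    from the vector field are the same, by symmetry. *)
Lemma loc_lie_trans X i j z v : smooth_vf X -> overlap i j z ->
  loc_lie X i z v = loc_lie X j (coords j (param i z)) (dtrans i j z v).
Proof.
move=> sX zj; have [zi xj] := (overlapP _ _ _).1 zj; have yj := coords_img xj.
have dX l y : img l y -> vdiff (vf_local X l) y.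
  move=> yl; apply: smoothv_vdiff yl.
  by apply: smooth_smoothv; [exact: open_img|exact: sX].
have dt := trans_differentiable zj.
have [_ E1] := dirder_comp v dt (dX _ _ yj).
have [||_ /(_ v) E2] := @dirder_apply _ _ _ _ (dtrans i j) (vf_local X i) z _ _ (dX _ _ zi).
- by apply: (open_near (overlap_open i j) zj) => y; exact: dtrans_linear.
- exact: vdiff_dtrans.
have E3 : dirder (vf_local X j) (coords j (param i z)) (dtrans i j z v) =
    dirder (fun y => dtrans i j y (vf_local X i z)) z v +
    dtrans i j z (dirder (vf_local X i) z v).
  rewrite -E2; apply: etrans (esym E1) _; apply: near_eq_dirder.
  by apply: (open_near (overlap_open i j) zj) => y; exact: vf_local_trans.
rewrite /loc_lie (dirder_one_form_trans (vf_local X i z) v zj) (vf_local_trans X zj).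
rewrite E3 (linD (one_form_local_linear yj)) (one_form_local_trans (dirder _ _ _) zj).
by rewrite (dirder_dtrans_comm zj (vf_local X i z) v) addrA.
Qed.

Lemma lie_der_at X x (w : 'I_1 -> E) : smooth_vf X ->
  lie_der X phi x w = loc_lie X (chart_at x) (coords (chart_at x) x) (w ord0).
Proof.
move=> sX; have zi := coords_img (chart_at_dom x).
rewrite /lie_der big_ord1 /loc_lie vf_local_at.
have w0 : w = fun=> w ord0 by apply/funext => a; rewrite (ord1 a).
have E1 (y : E) : dfwith w ord0 y = fun=> y.
  by apply/funext => a; rewrite dfwithE (ord1 a).
have E0 : (fun y => form_local phi (chart_at x) y w) = A (chart_at x) ^~ (w ord0).
  by apply/funext => z; rewrite {1}w0.
have dX : differentiable (vf_local X (chart_at x)) (coords (chart_at x) x).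
  exact: smooth_differentiable (sX _) zi.
by rewrite E0 E1 (dirder_derive (w ord0) dX) (one_form_local_at x).
Qed.

End OneForms.
End Charts.

Arguments open_img {R n M} i.
Arguments overlap_open {R n M} i j.

(** * The theorem *)

Section ChernWeil.
Context {R : realType} {n : nat} {M : manifold R n} {g : lieAlgebra R}.
Local Notation E := 'rV[R]_n.
Local Notation br := (@lie_br R g).
Context {omega : dform M 1 g} (omegaP : is_dform omega).
Local Notation A := (one_form_local omega).

Lemma form_local_curvature i z (w : 'I_2 -> E) : img i z ->
  form_local (curvature omega) i z w = loc_curv_form (A i) z w.
Proof.
move=> zi; have := form_local_ext_d omegaP w zi.
rewrite /loc_curv_form /loc_curv => <-.
by rewrite /one_form_local !form_localE.
Qed.

Lemma curvature_at x :
  curvature omega x = loc_curv_form (A (chart_at x)) (coords (chart_at x) x).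
Proof.
apply/funext => w; rewrite -form_local_curvature ?form_local_at //.
by apply: coords_img; exact: chart_at_dom.
Qed.

Context {k : nat} {f : ('I_k -> g) -> R} (fM : multilinear (f : _ -> R^o)).

(** In every chart [f^Omega] is the same algebraic expression in the local
    curvature. *)
Lemma form_local_form_of i z (v : 'I_(k.*2) -> E) : img i z ->
  form_local (form_of f (curvature omega)) i z v =
  alt_pairs (f : _ -> R^o) (loc_curv_form (A i) z) v.
Proof.
move=> zi; rewrite /form_local form_of_alt_pairs //.
rewrite -[LHS]/(alt_pairs _ (fun w => form_local (curvature omega) i z w) v).
by congr (alt_pairs _ _ v); apply/funext => w; exact: form_local_curvature.
Qed.

Lemma form_of_at x (v : 'I_(k.*2) -> E) : form_of f (curvature omega) x v =
  alt_pairs (f : _ -> R^o) (loc_curv_form (A (chart_at x)) (coords (chart_at x) x)) v.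
Proof. by rewrite form_of_alt_pairs // curvature_at. Qed.

Let linA i z : img i z -> linear (A i z).
Proof. exact: one_form_local_linear. Qed.

Let smA i v : smoothv (img i) (fun z => A i z v).
Proof. exact: one_form_local_smooth. Qed.

Lemma form_of_dform : is_dform (form_of f (curvature omega)).
Proof.
split=> [x|x|i v].
- have zi := coords_img (chart_at_dom x).
  have KM := loc_curv_form_multilinear (open_img _) (@linA _) (@smA _) zi.
  have FM := alt_pairs_multilinear fM KM.
  have -> : form_of f (curvature omega) x = alt_pairs (f : _ -> R^o)
    (loc_curv_form (A (chart_at x)) (coords (chart_at x) x)).
    by apply/funext => v; exact: form_of_at.
  exact: FM.
- by move=> v a b ab vab; rewrite form_of_at; exact: alt_pairs_alternating ab vab.
- have s := smoothv_alt_pairs fM v (open_img i)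
    (smoothv_loc_curv_form (open_img i) (@smA i)).
  by apply: smoothv_ext (open_img i) _ s => z zi; rewrite form_local_form_of.
Qed.

Lemma near_form_of x (v : 'I_(k.*2) -> E) u :
  dirder (fun z => form_local (form_of f (curvature omega)) (chart_at x) z v)
    (coords (chart_at x) x) u =
  dirder (fun z => alt_pairs (f : _ -> R^o) (loc_curv_form (A (chart_at x)) z) v)
    (coords (chart_at x) x) u.
Proof.
apply: near_eq_dirder.
apply: (open_near (open_img _) (coords_img (chart_at_dom x))) => z.
exact: form_local_form_of.
Qed.

Hypothesis fI : forall (X : g) (Y : 'I_k -> g),
  \sum_(a < k) f (dfwith Y a (br X (Y a))) = 0.

Lemma form_of_closed : closed_form (form_of f (curvature omega)).
Proof.
move=> x v; have zi := coords_img (chart_at_dom x).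
have := loc_chern_weil_closed fM fI (open_img _) (@smA _) v zi.
by apply: etrans; apply: eq_bigr => a _; rewrite near_form_of.
Qed.

Section Action.
Context {zeta : g -> vector_field M}.
Hypotheses (zetaS : forall X, smooth_vf (zeta X))
  (omegaL : forall X x v, lie_der (zeta X) omega x v = - br X (@omega x v)).

Lemma loc_lie_connection X i z v : img i z ->
  loc_lie omega (zeta X) i z v = - br X (A i z v).
Proof.
move=> zi; have zc : overlap i (chart_at (param i z)) z.
  by apply/overlapP; split=> //; exact: chart_at_dom.
rewrite (loc_lie_trans omegaP _ (zetaS X) zc) (one_form_local_trans _ _ zc).
set w := dtrans _ _ _ _.
apply: etrans (esym (lie_der_at omega (param i z) (fun=> w) (zetaS X))) _.
by rewrite omegaL -(one_form_local_at omega (param i z)).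
Qed.

Let smX X i : smoothv (img i) (vf_local (zeta X) i).
Proof. by apply: smooth_smoothv; [exact: open_img|exact: zetaS]. Qed.

Lemma form_of_invariant : g_invariant zeta (form_of f (curvature omega)).
Proof.
move=> X x v; have zi := coords_img (chart_at_dom x).
have LK u w := loc_lie_curv (open_img _) (@linA _) (@smA _) (@smX X _)
  (fun z v => @loc_lie_connection X _ z v) u w zi.
have := loc_chern_weil_invariant fM fI (open_img _) (@smA _) v zi LK.
rewrite vf_local_at => <-; rewrite /lie_der near_form_of; congr (_ + _).
apply: eq_bigr => a _; rewrite form_of_at dirder_derive //.
by apply: smooth_differentiable zi; exact: zetaS.
Qed.

Hypothesis omegaV : forall X x, @omega x (fun=> zeta X x) = X.

(** Both the form and the vertical field are carried to the preferred chart, where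
    the hypothesis applies. *)
Lemma one_form_local_vertical X i z : img i z -> A i z (vf_local (zeta X) i z) = X.
Proof.
move=> zi; have zc : overlap i (chart_at (param i z)) z.
  by apply/overlapP; split=> //; exact: chart_at_dom.
rewrite (one_form_local_trans _ _ zc) -vf_local_trans // vf_local_at.
by rewrite one_form_local_at omegaV.
Qed.

Lemma curvature_horizontal : horizontal zeta (curvature omega).
Proof.
move=> X x v; have zi := coords_img (chart_at_dom x).
have H w := loc_curv_horizontal (open_img _) (@linA _) (@smA _) (@smX X _)
  (fun z v => @loc_lie_connection X _ z v) w zi (@one_form_local_vertical X _).
rewrite vf_local_at in H.
rewrite /insertion curvature_at /loc_curv_form unlift_none; exact: H.
Qed.

Lemma form_of_horizontal : horizontal zeta (form_of f (curvature omega)).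
Proof.
case: k f fM => [|m] h hM X x v; first by [].
(* Only the first slot is covered by [horizontal]; skewness gives the other. *)
have curv0 (w : 'I_2 -> E) : w ord0 = zeta X x -> curvature omega x w = 0.
  move=> w0; rewrite -[RHS](@curvature_horizontal X x (fun=> w ord_max)).
  rewrite /insertion; congr (curvature omega x _); apply/funext => c.
  have [->|->] := ord2P c; first by rewrite unlift_none.
  by case: unliftP => // /eqP; rewrite -val_eqE.
pose u (a : 'I_(m.*2).+2) := if unlift ord0 a is Some b then v b else zeta X x.
rewrite -[LHS]/(form_of h (curvature omega) x u) form_of_alt_pairs //.
apply: (@alt_pairs_eq0 _ m.+1 _ _ _ _ u (ord0 : 'I_(m.*2).+2) hM) => w [c].
rewrite /u unlift_none => wc.
have [c0|c1] := ord2P c; first by apply: curv0; rewrite -c0.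
have := curv0 (fun d => if d == ord0 then w ord_max else w ord0).
rewrite eqxx -c1 wc => /(_ erefl); rewrite !curvature_at /loc_curv_form /= => H.
by rewrite loc_curv_anti -c1 wc H oppr0.
Qed.

End Action.
End ChernWeil.

Theorem lemma7p4 (R : realType) (n : nat) (M : manifold R n) (g : lieAlgebra R)
    (zeta : g -> vector_field M) (omega : dform M 1 g)
    (k : nat) (f : ('I_k -> g) -> R) :
  is_gmanifold zeta ->
  principal_connection zeta omega ->
  invariant_multilinear f ->
  [/\ is_dform (form_of f (curvature omega)),
      closed_form (form_of f (curvature omega)) &
      g_invariant zeta (form_of f (curvature omega))] /\
  (free_gmanifold zeta ->
     [/\ horizontal zeta (curvature omega),
         is_basic zeta (form_of f (curvature omega)) &
         closed_form (form_of f (curvature omega))]).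
Proof.
move=> [zetaS _ _] [omegaP omegaL omegaZ] [fM fI].
have fD := form_of_dform omegaP fM; have fC := form_of_closed omegaP fM fI.
have fL := form_of_invariant omegaP fM fI zetaS omegaL.
(* Freeness cancels [zeta] in the reproducing identity of the connection. *)
split=> // free; have omegaV X x : omega x (fun=> zeta X x) = X.
  by apply: (free x); exact: omegaZ.
by split=> //; [exact: curvature_horizontal | split=> //; exact: form_of_horizontal].
Qed.
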